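(* Let $E=TM\oplus T^*M\oplus\mathcal G$ be a standard Courant algebroid with data $(\nabla,R,H)$ and let $\mathcal J$ be a non-degenerate generalised almost complex structure on $E$ determined by the data $J,\tilde A,B,\nu$ (with $\tilde A=A+\nu B^{-1}\nu^*$). Then $\mathcal J$ is integrable if and only if the following conditions hold: 1. $B^{-1}$ is a symplectic form. 2. $\tilde A\in\Gamma(\mathrm{End}\,\mathcal G)$ is an integrable complex structure, i.e. for any $p\in M$ the $(1,0)$-eigenspace of $\tilde A_p$ is closed under the Lie bracket of $\mathcal G_p$. 3. $\tilde\nabla\tilde A=0$, where $\tilde\nabla_X:=\nabla_X+\mathrm{ad}_{\nu B^{-1}X}$ for $X\in TM$. 4. The covariant derivative of the $\mathcal G$-valued 1-form $\nu B^{-1}$ satisfies $$d^\nabla(\nu B^{-1})+[\nu B^{-1},\nu B^{-1}]_{\mathcal G}+R=0.$$ 5. The exterior derivative of the 2-form $B_J$, $B_J(X,Y):=-\frac12\big(B^{-1}(JX,Y)+B^{-1}(X,JY)\big)$, satisfies $$dB_J+H+\Big\langle\Big(R-\tfrac13[\nu B^{-1},\nu B^{-1}]_{\mathcal G}\Big)\wedge\nu B^{-1}\Big\rangle_{\mathcal G}=0.$$ Here the $\mathcal G$-valued 2-form $[\nu B^{-1},\nu B^{-1}]_{\mathcal G}$ is given by $[\nu B^{-1},\nu B^{-1}]_{\mathcal G}(X,Y):=[\nu B^{-1}X,\nu B^{-1}Y]_{\mathcal G}$, $X,Y\in TM$.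
   Context: $M$ is a connected smooth manifold. A quadratic Lie algebra bundle $(\mathcal G,[\cdot,\cdot]_{\mathcal G},\langle\cdot,\cdot\rangle_{\mathcal G})$ is a vector bundle over $M$ whose fibres are smoothly varying Lie algebras with ad-invariant non-degenerate symmetric bilinear form. A standard Courant algebroid is $E=TM\oplus T^*M\oplus\mathcal G$ with data $(\nabla,R,H)$, where $\nabla$ is a connection on $\mathcal G$ preserving $[\cdot,\cdot]_{\mathcal G}$ and $\langle\cdot,\cdot\rangle_{\mathcal G}$, $R\in\Omega^2(M,\mathcal G)$, $H\in\Omega^3(M)$, $R^\nabla(X,Y)r=[R(X,Y),r]_{\mathcal G}$, $d^\nabla R=0$, $dH=\langle R\wedge R\rangle_{\mathcal G}$. Here $\langle\alpha\wedge\beta\rangle_{\mathcal G}$ is the exterior product combined with $\langle\cdot,\cdot\rangle_{\mathcal G}$; for a 2-form $\omega_2$ and a 1-form $\omega_1$, $\langle\omega_2\wedge\omega_1\rangle_{\mathcal G}(X,Y,Z)=\sum_{\mathrm{cycl}(X,Y,Z)}\langle\omega_2(X,Y),\omega_1(Z)\rangle_{\mathcal G}$, and $\langle R\wedge R\rangle_{\mathcal G}(X,Y,Z,V)=2\sum_{\mathrm{cycl}(X,Y,Z)}\langle R(X,Y),R(Z,V)\rangle_{\mathcal G}$. Anchor: projection $\pi:E\to TM$. Scalar product: $\langle X+\xi+r,Y+\eta+\tilde r\rangle=\frac12(\eta(X)+\xi(Y))+\langle r,\tilde r\rangle_{\mathcal G}$. Dorfman bracket: $[X,Y]=\mathcal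 L_XY+i_Yi_XH+R(X,Y)$, $[X,r]=-2\langle i_XR,r\rangle_{\mathcal G}+\nabla_Xr$, $[r_1,r_2]=2\langle\nabla r_1,r_2\rangle_{\mathcal G}+[r_1,r_2]_{\mathcal G}$, $[X,\eta]=\mathcal L_X\eta$, $[\eta_1,\eta_2]=[r,\eta]=0$, together with $[u,v]+[v,u]=2d\langle u,v\rangle$. Unless otherwise stated Courant algebroids are of neutral signature. A generalised almost complex structure is a skew-symmetric $\mathcal J\in\Gamma(\mathrm{End}\,E)$ with $\mathcal J^2=-\mathrm{Id}$; it is integrable if the sections of its $i$-eigenbundle in $E^{\mathbb C}$ are closed under the Dorfman bracket. Its components $J,A,B,C,\mu,\nu$ are defined by $\mathcal JX=JX+CX+\mu X$, $\mathcal J\xi=B\xi-J^*\xi+\nu\xi$, $\mathcal Jr=-\nu^*r-\mu^*r+Ar$, where $J^*$ is the dual map and $\nu^*:\mathcal G\to TM$, $\mu^*:\mathcal G\to T^*M$ satisfy $\xi(\nu^*r)=2\langle r,\nu\xi\rangle_{\mathcal G}$, $(\mu^*r)(X)=2\langle r,\mu X\rangle_{\mathcal G}$. $\mathcal J$ is non-degenerate if $B:T^*M\to TM$ is bijective. Non-degenerate generalised almost complex structures correspond bijectively to data $(J,\tilde A,B,\nu)$ with $B^*=-B$ bijective, $\tilde A^*=-\tilde A$, $\tilde A^2=-\mathrm{Id}$, $JB-BJ^*=\nu^*\nu$, via $A=\tilde A-\nu B^{-1}\nu^*$, $C=-B^{-1}(\nu^*\tilde A\nu B^{-1}+\mathrm{Id})-J^*B^{-1}J$,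 $\mu=\nu B^{-1}J-\tilde A\nu B^{-1}$. $B^{-1}:TM\to T^*M$ is regarded as the 2-form $B^{-1}(X,Y)=(B^{-1}X)(Y)$. The $(1,0)$-eigenspace of $\tilde A_p$ is its $i$-eigenspace in $\mathcal G_p^{\mathbb C}$. $\mathrm{ad}$ is the adjoint representation of $\mathcal G$: $\mathrm{ad}_rs=[r,s]_{\mathcal G}$. *)

(* Defs.v *)
From HB Require Import structures.
From mathcomp Require Import all_boot all_order all_algebra.
From mathcomp Require Import ring.
From mathcomp Require Import mathcomp_extra boolp classical_sets functions.
From mathcomp Require Import interval_inference reals topology normedtype landau derive.

Set Implicit Arguments.
Unset Strict Implicit.
Unset Printing Implicit Defensive.

Import Order.TTheory GRing.Theory Num.Theory.
Import numFieldNormedType.Exports.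

Local Open Scope classical_set_scope.
Local Open Scope ring_scope.

Section EuclideanSmooth.
Context {R : realType} {n : nat}.
Implicit Types (W : set 'rV[R]_n) (f g : 'rV[R]_n -> R).

(* f has k successive (Frechet) derivatives on W, all directional derivatives of
   each order being again differentiable at the next step; for all k this is
   being C^oo on W. *)
Fixpoint diff_upto (k : nat) W f : Prop :=
  if k is k'.+1 then
    (forall x, W x -> differentiable f x) /\ (forall v, diff_upto k' W ('D_v f))
  else True.

Definition smooth_open W f := forall k, diff_upto k W f.

Lemma near_differentiable f g x : {near x, f =1 g} ->
  differentiable f x -> differentiable g x.
Proof.
move=> fg df.
have fgx : f x = g x by exact: (nbhs_singleton fg).
have [dc de] := (diff_locallyP x f).1 df.
have nfg : \forall h \near (0 : 'rV[R]_n), f (h + x) = g (h + x).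
  move: fg; rewrite (near_shift 0 x); apply: filterS => h /=.
  by rewrite subr0.
have e : g \o shift x = cst (g x) + 'd f x +o_ 0 id.
  apply/eqaddoP => _/posnumP[e].
  move/eqaddoP: de => /(_ _ (gt0 e)); apply: filterS2 nfg => h fgh.
  by rewrite !fctE /= -fgx -fgh.
have du := diff_unique dc e.
by apply/diff_locallyP; rewrite du.
Unshelve. all: by end_near. Qed.

Lemma diff_upto_ext k W f g : open W -> (forall x, W x -> f x = g x) ->
  diff_upto k W f -> diff_upto k W g.
Proof.
move=> oW; elim: k f g => //= k IH f g fg [df Df].
have nfg x : W x -> {near x, f =1 g}.
  move=> Wx; have : nbhs x W by exact: open_nbhs_nbhs.
  by apply: filterS => y; exact: fg.
split => [x Wx|v]; first by apply: near_differentiable (df x Wx); exact: nfg.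
apply: IH (Df v) => x Wx; apply: near_eq_derive; exact: nfg.
Qed.

Lemma diff_upto_sub k W W' f : W' `<=` W -> diff_upto k W f -> diff_upto k W' f.
Proof.
move=> sW; elim: k f => //= k IH f [df Df].
by split=> [x /sW Wx|v]; [exact: df|exact: IH].
Qed.

Lemma diff_upto_cst k W c : diff_upto k W (fun=> c).
Proof.
elim: k c => //= k IH c; split=> [x _|v]; first exact: differentiable_cst.
suff -> : 'D_v (fun _ : 'rV[R]_n => c) = fun=> 0 by exact: IH.
by apply/funext => x; rewrite derive_cst.
Qed.

Lemma diff_uptoS k W f : diff_upto k.+1 W f -> diff_upto k W f.
Proof.
elim: k f => //= k IH f [df Df]; split => // v; apply: IH; exact: Df.
Qed.

Lemma diff_uptoD k W f g : open W -> diff_upto k W f -> diff_upto k W g ->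
  diff_upto k W (f + g).
Proof.
move=> oW; elim: k f g => //= k IH f g [df Df] [dg Dg].
split=> [x Wx|v]; first by apply: differentiableD; [exact: df|exact: dg].
apply: (@diff_upto_ext _ _ ('D_v f + 'D_v g)) => //; last exact: IH.
by move=> x Wx; rewrite deriveD//; apply: diff_derivable; [exact: df|exact: dg].
Qed.

Lemma diff_uptoM k W f g : open W -> diff_upto k W f -> diff_upto k W g ->
  diff_upto k W (f * g).
Proof.
move=> oW; elim: k f g => // k IH f g fS gS.
have [f0 g0] := (diff_uptoS fS, diff_uptoS gS).
case: fS gS => df Df [dg Dg].
split=> [x Wx|v]; first by apply: differentiableM; [exact: df|exact: dg].
apply: (@diff_upto_ext _ _ (f * 'D_v g + g * 'D_v f)) => //.
  by move=> x Wx; rewrite deriveM//; apply: diff_derivable; [exact: df|exact: dg].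
by apply: diff_uptoD => //; [exact: (IH _ _ f0 (Dg v))|exact: (IH _ _ g0 (Df v))].
Qed.

End EuclideanSmooth.

(* A Hausdorff second countable space with a C^oo atlas, not assumed maximal.
   cinv a is total, but it is only meaningful on the range of the chart cmap a,
   where it is the inverse of cmap a. *)
Record manifold (R : realType) (n : nat) := Manifold {
  points :> topologicalType ;
  points_hausdorff : hausdorff_space points ;
  points_second_countable : @second_countable points ;
  chart : Type ;
  cdom : chart -> set points ;
  cmap : chart -> points -> 'rV[R]_n ;
  cinv : chart -> 'rV[R]_n -> points ;
  cdom_open : forall a, open (cdom a) ;
  cdom_cover : forall p, exists a, cdom a p ;
  cran_open : forall a, open (cmap a @` cdom a) ;
  cmapK : forall a p, cdom a p -> cinv a (cmap a p) = p ;
  cmap_continuous : forall a p, cdom a p -> {for p, continuous (cmap a)} ;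
  cinv_continuous : forall a x, (cmap a @` cdom a) x ->
    {for x, continuous (cinv a)} ;
  transition_smooth : forall a b (j : 'I_n),
    smooth_open (cmap a @` (cdom a `&` cdom b))
      (fun x => cmap b (cinv a x) ord0 j) }.

Section SmoothFunctions.
Context {R : realType} {n : nat} (M : manifold R n).
Implicit Types (U : set M) (f g : M -> R).

Definition smooth_on U f : Prop :=
  forall a, smooth_open (cmap a @` (cdom a `&` U)) (f \o cinv a).

Lemma chart_image_open U (a : chart M) : open U ->
  open (cmap a @` (cdom a `&` U)).
Proof.
move=> oU; rewrite openE => _ [p [ap Up] <-].
have ran : (cmap a @` cdom a) (cmap a p) by exists p.
have n1 : nbhs (cmap a p) (cmap a @` cdom a).
  by apply: open_nbhs_nbhs; split => //; exact: cran_open.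
have n2 : nbhs (cmap a p) (cinv a @^-1` U).
  apply: (cinv_continuous ran); rewrite cmapK//.
  exact: open_nbhs_nbhs.
rewrite /interior; apply: filterS2 n1 n2 => _ [q aq <-] /=.
by rewrite cmapK// => Uq; exists q.
Qed.

Lemma smooth_on_cst U (c : R) : smooth_on U (fun=> c).
Proof. by move=> a k; exact: (diff_upto_cst k _ c). Qed.

Lemma smooth_onD U f g : open U -> smooth_on U f -> smooth_on U g ->
  smooth_on U (f + g).
Proof.
move=> oU sf sg a k; apply: (@diff_uptoD _ _ k _ (f \o cinv a) (g \o cinv a)).
- exact: chart_image_open.
- exact: sf.
- exact: sg.
Qed.

Lemma smooth_onM U f g : open U -> smooth_on U f -> smooth_on U g ->
  smooth_on U (f * g).
Proof.
move=> oU sf sg a k; apply: (@diff_uptoM _ _ k _ (f \o cinv a) (g \o cinv a)).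
- exact: chart_image_open.
- exact: sf.
- exact: sg.
Qed.

Lemma smooth_on_ext U f g : open U -> (forall p, U p -> f p = g p) ->
  smooth_on U f -> smooth_on U g.
Proof.
move=> oU fg sf a k; apply: (@diff_upto_ext _ _ k _ (f \o cinv a)).
- exact: chart_image_open.
- by move=> _ [p [ap Up] <-] /=; rewrite cmapK//; exact: fg.
- exact: sf.
Qed.

Lemma smooth_onT U f : smooth_on setT f -> smooth_on U f.
Proof.
move=> sf a k; apply: diff_upto_sub (sf a k).
by move=> _ [p [ap _] <-]; exists p.
Qed.

Definition smooth_pred : {pred M -> R} := fun f => `[< smooth_on setT f >].

(* The ring C^oo(M). *)
Record Cinf := MkCinf { cfun :> M -> R ; _ : cfun \in smooth_pred }.

HB.instance Definition _ := [isSub for cfun].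
HB.instance Definition _ := [Choice of Cinf by <:].

Lemma smooth_subring_closed : subring_closed smooth_pred.
Proof.
have Hc c : smooth_on setT (fun _ : M => c) by exact: smooth_on_cst.
have HM f g : smooth_on setT f -> smooth_on setT g -> smooth_on setT (f * g).
  by apply: smooth_onM; exact: openT.
split=> [|f g /asboolP sf /asboolP sg|f g /asboolP sf /asboolP sg].
- by apply/asboolP; exact: Hc.
- apply/asboolP; rewrite -[- g]mulN1r.
  by apply: smooth_onD; [exact: openT| |apply: HM => //; exact: (Hc (- 1))].
- by apply/asboolP; exact: HM.
Qed.

HB.instance Definition _ :=
  GRing.SubChoice_isSubComPzRing.Build (M -> R) smooth_pred Cinf
    smooth_subring_closed.

Lemma smooth_scale_closed : GRing.subsemimod_closed smooth_pred.
Proof.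
have [s1 sB sM] := smooth_subring_closed.
have s0 : 0 \in smooth_pred by rewrite -(subrr 1); exact: sB.
have sN f : f \in smooth_pred -> - f \in smooth_pred.
  by move=> sf; rewrite -sub0r; exact: sB.
split; first split => //.
  by move=> f g sf sg; rewrite -[g]opprK; apply: sB => //; exact: sN.
move=> c f sf.
have -> : c *: f = (fun=> c) * f by [].
by apply: sM => //; apply/asboolP; exact: smooth_on_cst.
Qed.

HB.instance Definition _ :=
  GRing.SubZmodule_isSubLmodule.Build R (M -> R) smooth_pred Cinf
    smooth_scale_closed.

Lemma CinfP (f : Cinf) : smooth_on setT f.
Proof. by case: f => f /= /asboolP. Qed.

End SmoothFunctions.

Section VectorFields.
Context {R : realType} {n : nat} (M : manifold R n).
Local Notation C := (Cinf M).

(* Vector fields are the R-linear derivations of C^oo(M), and tensor fields on M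
   (one-forms, differential forms, bundle maps between TM, T*M and a vector
   bundle V) are C^oo(M)-multilinear maps between modules of sections. *)
Definition derivation (X : C -> C) : Prop :=
  [/\ forall f g, X (f + g) = X f + X g,
      forall (c : R) f, X (c *: f) = c *: X f &
      forall f g, X (f * g) = X f * g + f * X g].

Definition vf_pred : {pred C -> C^o} := fun X => `[< derivation X >].

Record vf := MkVf { vact : C -> C^o ; _ : vact \in vf_pred }.

HB.instance Definition _ := [isSub for vact].
HB.instance Definition _ := [Choice of vf by <:].

Lemma Cinf_scaleAl (c : R) (f g : C) : c *: (f * g) = (c *: f) * g.
Proof. by apply/val_inj/funext => p; exact: mulrA. Qed.

Lemma Cinf_scaleAr (c : R) (f g : C) : c *: (f * g) = f * (c *: g).
Proof. by rewrite mulrC Cinf_scaleAl mulrC. Qed.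

Lemma vf_submod_closed : submod_closed vf_pred.
Proof.
split=> [|f X Y /asboolP [XD XZ XM] /asboolP [YD YZ YM]]; apply/asboolP.
  split=> [g h|c g|g h]; rewrite /GRing.zero /= /cst/=.
  - by rewrite addr0.
  - by rewrite scaler0.
  - by rewrite mul0r mulr0 addr0.
have E g : (f *: X + Y) g = f * X g + Y g by [].
split=> [g h|c g|g h]; rewrite !E.
- by rewrite XD YD mulrDr addrACA.
- by rewrite XZ YZ scalerDr Cinf_scaleAr.
- by rewrite XM YM !mulrDr !mulrDl addrACA !mulrA [f * g]mulrC.
Qed.

HB.instance Definition _ := GRing.SubChoice_isSubLmodule.Build C (C -> C^o)
  vf_pred vf (GRing.submod_closed_semi vf_submod_closed).

Definition vapp (X : vf) (f : C) : C := vact X f.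
Coercion vapp : vf >-> Funclass.

Lemma vf_derivation (X : vf) : derivation X.
Proof. by case: X => X pX; exact: (asboolW pX). Qed.

Lemma vbr_subproof (X Y : vf) :
  ((fun f => X (Y f) - Y (X f)) : C -> C^o) \in vf_pred.
Proof.
have [[XD XZ XM] [YD YZ YM]] := (vf_derivation X, vf_derivation Y).
apply/asboolP; split=> [f g|c f|f g].
- by rewrite YD XD XD YD opprD addrACA.
- by rewrite YZ XZ XZ YZ scalerBr.
- rewrite YM XD !XM YD !YM.
  by ring.
Qed.

Definition vbr (X Y : vf) : vf := MkVf (vbr_subproof X Y).

Definition oneform_pred : {pred vf -> C^o} := fun xi =>
  `[< forall (f : C) (X Y : vf), xi (f *: X + Y) = f *: xi X + xi Y >].

Record oneform := MkOneform { oact : vf -> C^o ; _ : oact \in oneform_pred }.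

HB.instance Definition _ := [isSub for oact].
HB.instance Definition _ := [Choice of oneform by <:].

Lemma oneform_submod_closed : submod_closed oneform_pred.
Proof.
split=> [|g xi eta /asboolP xiL /asboolP etaL]; apply/asboolP => f X Y.
  by rewrite /GRing.zero /= /cst/= scaler0 addr0.
have E Z : (g *: xi + eta) Z = g *: xi Z + eta Z by [].
rewrite !E xiL etaL !scalerDr !scalerA [g * f]mulrC addrACA.
by [].
Qed.

HB.instance Definition _ := GRing.SubChoice_isSubLmodule.Build C (vf -> C^o)
  oneform_pred oneform (GRing.submod_closed_semi oneform_submod_closed).

Definition oapply (xi : oneform) (X : vf) : C := oact xi X.
Coercion oapply : oneform >-> Funclass.

Lemma oneformP (xi : oneform) (f : C) X Y : xi (f *: X + Y) = f * xi X + xi Y.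
Proof. by case: xi => xi pxi; exact: (asboolW pxi). Qed.

End VectorFields.

(* A vector bundle of rank k: its fibres, and local frames bframe i over an open
   cover bdom i whose mutual coordinates are smooth. *)
Record vbundle (R : realType) (n : nat) (M : manifold R n) (k : nat) := VBundle {
  fib : M -> vectType R ;
  triv : Type ;
  bdom : triv -> set M ;
  bframe : triv -> forall p, k.-tuple (fib p) ;
  bdom_open : forall i, open (bdom i) ;
  bdom_cover : forall p, exists i, bdom i p ;
  bframe_basis : forall i p, bdom i p -> basis_of fullv (bframe i p) ;
  bframe_smooth : forall i i' (j j' : 'I_k),
    smooth_on (bdom i `&` bdom i')
      (fun p => coord (bframe i p) j (tnth (bframe i' p) j')) }.

Section Sections.
Context {R : realType} {n : nat} {M : manifold R n} {k : nat} (V : vbundle M k).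
Local Notation C := (Cinf M).

Definition smooth_sect (s : forall p, fib V p) : Prop :=
  forall (i : triv V) (j : 'I_k),
    smooth_on (bdom i) (fun p => coord (bframe i p) j (s p)).

Record sect := MkSect { sfun :> forall p, fib V p ; sectP : smooth_sect sfun }.

Lemma sect_eq (s t : sect) : (forall p, s p = t p) -> s = t.
Proof.
case: s t => [s sS] [t tS] /= st.
have e : s = t by exact/functional_extensionality_dep.
by case: _ / e tS => tS; congr MkSect; exact: Prop_irrelevance.
Qed.

HB.instance Definition _ := gen_eqMixin sect.
HB.instance Definition _ := gen_choiceMixin sect.

Lemma sect0_subproof : smooth_sect (fun p => 0).
Proof.
move=> i j; rewrite (_ : (fun p => _) = fun=> 0); first exact: smooth_on_cst.
by apply/funext => p; rewrite linear0.
Qed.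

Lemma sectD_subproof (s t : sect) : smooth_sect (fun p => s p + t p).
Proof.
move=> i j.
rewrite (_ : (fun p => _) = (fun p => coord (bframe i p) j (s p)) +
                            (fun p => coord (bframe i p) j (t p))).
  by apply: smooth_onD; [exact: bdom_open|exact: sectP|exact: sectP].
by apply/funext => p; rewrite linearD.
Qed.

Lemma sectZ_subproof (f : C) (s : sect) : smooth_sect (fun p => f p *: s p).
Proof.
move=> i j.
rewrite (_ : (fun p => _) = (f : M -> R) * (fun p => coord (bframe i p) j (s p))).
  apply: smooth_onM; [exact: bdom_open|exact/smooth_onT/CinfP|exact: sectP].
by apply/funext => p; rewrite linearZ.
Qed.

Lemma sectN_subproof (s : sect) : smooth_sect (fun p => - s p).
Proof.
move=> i j.
rewrite (_ : (fun p => _) = (fun=> -1) * (fun p => coord (bframe i p) j (s p))).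
  by apply: smooth_onM; [exact: bdom_open|exact: smooth_on_cst|exact: sectP].
by apply/funext => p; rewrite linearN/= !fctE mulN1r.
Qed.

Definition sect0 := MkSect sect0_subproof.
Definition sectD s t := MkSect (sectD_subproof s t).
Definition sectN s := MkSect (sectN_subproof s).
Definition sectZ f s := MkSect (sectZ_subproof f s).

Fact sectDA : associative sectD.
Proof. by move=> s t u; apply: sect_eq => p /=; rewrite addrA. Qed.
Fact sectDC : commutative sectD.
Proof. by move=> s t; apply: sect_eq => p /=; rewrite addrC. Qed.
Fact sect0D : left_id sect0 sectD.
Proof. by move=> s; apply: sect_eq => p /=; rewrite add0r. Qed.
Fact sectND : left_inverse sect0 sectN sectD.
Proof. by move=> s; apply: sect_eq => p /=; rewrite addNr. Qed.

HB.instance Definition _ :=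
  GRing.isZmodule.Build sect sectDA sectDC sect0D sectND.

Fact sectZA (f g : C) s : sectZ f (sectZ g s) = sectZ (f * g) s.
Proof. by apply: sect_eq => p /=; rewrite scalerA. Qed.
Fact sect1Z : left_id 1 sectZ.
Proof. by move=> s; apply: sect_eq => p /=; rewrite scale1r. Qed.
Fact sectZDr : right_distributive sectZ +%R.
Proof. by move=> f s t; apply: sect_eq => p /=; rewrite scalerDr. Qed.
Fact sectZDl s : {morph sectZ^~ s : f g / f + g}.
Proof. by move=> f g; apply: sect_eq => p /=; rewrite scalerDl. Qed.

HB.instance Definition _ :=
  GRing.Zmodule_isLmodule.Build C sect sectZA sect1Z sectZDr sectZDl.

(* The endomorphism of the fibre over p induced by a C^oo(M)-linear
   endomorphism A of the sections: a is sent to (A s) p for a section s with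
   s p = a; by tensoriality the choice of s is irrelevant. *)
Definition endo_at (A : sect -> sect) (p : M) (a : fib V p) : fib V p :=
  A (xget 0 [set s : sect | s p = a]) p.

End Sections.
Arguments endo_at {R n M k V} A p a.

Definition lie_bracket_axioms (K : fieldType) (L : vectType K)
    (br : L -> L -> L) : Prop :=
  [/\ forall a x y z, br (a *: x + y) z = a *: br x z + br y z,
      forall a x y z, br x (a *: y + z) = a *: br x y + br x z,
      forall x, br x x = 0 &
      forall x y z, br x (br y z) + br y (br z x) + br z (br x y) = 0].

Definition ad_invariant_form (K : fieldType) (L : vectType K)
    (br : L -> L -> L) (q : L -> L -> K) : Prop :=
  [/\ forall a x y z, q (a *: x + y) z = a * q x z + q y z,
      forall x y, q x y = q y x,
      forall x, (forall y, q x y = 0) -> x = 0 &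
      forall x y z, q (br x y) z = q x (br y z)].

(* A basis is orthogonal with m vectors of square 1 and m of square -1. *)
Definition neutral_form (R : realType) (L : vectType R) (q : L -> L -> R) :=
  exists (m : nat) (e : (m + m).-tuple L), basis_of fullv e /\
    forall i j, q (tnth e i) (tnth e j) =
      if i == j then (if (i < m)%N then 1 else -1) else 0.

Record quad_lie_bundle (R : realType) (n : nat) (M : manifold R n) (k : nat) :=
  QuadLieBundle {
  qvb :> vbundle M k ;
  lie : forall p, fib qvb p -> fib qvb p -> fib qvb p ;
  qform : forall p, fib qvb p -> fib qvb p -> R ;
  lie_axioms : forall p, lie_bracket_axioms (@lie p) ;
  qform_axioms : forall p, ad_invariant_form (@lie p) (@qform p) ;
  lie_smooth : forall r s : sect qvb, smooth_sect (fun p => lie (r p) (s p)) ;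
  qform_smooth : forall r s : sect qvb,
    (fun p => qform (r p) (s p)) \in @smooth_pred R n M }.

Section Calculus.
Context {R : realType} {n : nat} {M : manifold R n} {k : nat}.
Context (G : quad_lie_bundle M k).
Local Notation C := (Cinf M).
Local Notation Gsec := (sect G).
Implicit Types (X Y Z : vf M) (r s : Gsec) (xi eta : oneform M).

Definition slie r s : Gsec := MkSect (lie_smooth r s).
Definition sform r s : C := MkCinf (qform_smooth r s).

(* The sum over cyclic permutations of (X, Y, Z). *)
Definition cyc (T : nmodType) (F : vf M -> vf M -> vf M -> T) X Y Z : T :=
  F X Y Z + F Y Z X + F Z X Y.

Definition is_2form (T : lmodType C) (w : vf M -> vf M -> T) : Prop :=
  [/\ forall (f : C) X Y Z, w (f *: X + Y) Z = f *: w X Z + w Y Z,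
      forall (f : C) X Y Z, w X (f *: Y + Z) = f *: w X Y + w X Z &
      forall X, w X X = 0].

Definition is_3form (T : lmodType C) (h : vf M -> vf M -> vf M -> T) : Prop :=
  [/\ forall (f : C) X X' Y Z, h (f *: X + X') Y Z = f *: h X Y Z + h X' Y Z,
      forall (f : C) X Y Y' Z, h X (f *: Y + Y') Z = f *: h X Y Z + h X Y' Z,
      forall (f : C) X Y Z Z', h X Y (f *: Z + Z') = f *: h X Y Z + h X Y Z',
      forall X Y, h X X Y = 0 &
      forall X Y, h X Y Y = 0].

(* d2 and d3 are the exterior derivatives of a 2-form and of a 3-form, dD1 and
   dD2 the exterior covariant derivatives of a 1-form and of a 2-form with values
   in G: the invariant formulas, without normalising factors. *)
Definition d2 (w : vf M -> vf M -> C) : vf M -> vf M -> vf M -> C :=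
  cyc (fun X Y Z => X (w Y Z) - w (vbr X Y) Z).

Definition d3 (h : vf M -> vf M -> vf M -> C) X Y Z V : C :=
  X (h Y Z V) - Y (h X Z V) + Z (h X Y V) - V (h X Y Z)
  - h (vbr X Y) Z V + h (vbr X Z) Y V - h (vbr X V) Y Z
  - h (vbr Y Z) X V + h (vbr Y V) X Z - h (vbr Z V) X Y.

Definition is_connection (D : vf M -> Gsec -> Gsec) : Prop :=
  [/\ forall (f : C) X Y s, D (f *: X + Y) s = f *: D X s + D Y s,
      forall X s t, D X (s + t) = D X s + D X t &
      forall X (f : C) s, D X (f *: s) = X f *: s + f *: D X s].

Definition curvature (D : vf M -> Gsec -> Gsec) X Y s : Gsec :=
  D X (D Y s) - D Y (D X s) - D (vbr X Y) s.

Definition dD1 (D : vf M -> Gsec -> Gsec) (a : vf M -> Gsec) X Y : Gsec :=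
  D X (a Y) - D Y (a X) - a (vbr X Y).

Definition dD2 (D : vf M -> Gsec -> Gsec) (w : vf M -> vf M -> Gsec) :
    vf M -> vf M -> vf M -> Gsec :=
  cyc (fun X Y Z => D X (w Y Z) - w (vbr X Y) Z).

Definition wedge21 (w : vf M -> vf M -> Gsec) (a : vf M -> Gsec) :
    vf M -> vf M -> vf M -> C :=
  cyc (fun X Y Z => sform (w X Y) (a Z)).

Definition wedge22 (w : vf M -> vf M -> Gsec) X Y Z V : C :=
  cyc (fun X Y Z => sform (w X Y) (w Z V)) X Y Z *+ 2.

Record courant_data := CourantData {
  conn : vf M -> Gsec -> Gsec ;
  Rform : vf M -> vf M -> Gsec ;
  Hform : vf M -> vf M -> vf M -> C ;
  conn_connection : is_connection conn ;
  conn_lie : forall X r s,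
    conn X (slie r s) = slie (conn X r) s + slie r (conn X s) ;
  conn_form : forall X r s,
    X (sform r s) = sform (conn X r) s + sform r (conn X s) ;
  Rform_2form : is_2form Rform ;
  Hform_3form : is_3form (Hform : vf M -> vf M -> vf M -> C^o) ;
  curvatureE : forall X Y r, curvature conn X Y r = slie (Rform X Y) r ;
  dRform : forall X Y Z, dD2 conn Rform X Y Z = 0 ;
  dHform : forall X Y Z V, d3 Hform X Y Z V = wedge22 Rform X Y Z V }.

Lemma mk1form_subproof (a : vf M -> C) :
  (forall (f : C) X Y, a (f *: X + Y) = f * a X + a Y) ->
  (a : vf M -> C^o) \in oneform_pred (M := M).
Proof. by move=> aL; apply/asboolP. Qed.

Definition mk1form (a : vf M -> C) aL : oneform M :=
  MkOneform (@mk1form_subproof a aL).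

Lemma vfE (f g : C) X Y : (f *: X + Y) g = f * X g + Y g.
Proof. by []. Qed.

Lemma vbrZr X (f : C) Y Z : vbr X (f *: Y + Z) = X f *: Y + f *: vbr X Y + vbr X Z.
Proof.
have [XD XZ XM] := vf_derivation X.
apply/val_inj/funext => g.
have -> : val (vbr X (f *: Y + Z)) g = X (f * Y g + Z g) - (f * Y (X g) + Z (X g)).
  by [].
have -> : val (X f *: Y + f *: vbr X Y + vbr X Z) g =
  X f * Y g + f * (X (Y g) - Y (X g)) + (X (Z g) - Z (X g)) by [].
rewrite XD XM. by ring.
Qed.

Fact dfun_subproof (f : C) (g : C) X Y : (g *: X + Y) f = g * X f + Y f.
Proof. by []. Qed.
Definition dfun (f : C) : oneform M := @mk1form (fun X => X f) (dfun_subproof f).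

Fact lieD_subproof X eta (f : C) Y Z :
  X (eta (f *: Y + Z)) - eta (vbr X (f *: Y + Z)) =
  f * (X (eta Y) - eta (vbr X Y)) + (X (eta Z) - eta (vbr X Z)).
Proof.
have [XD XZ XM] := vf_derivation X.
rewrite vbrZr -addrA !oneformP XD XM. by ring.
Qed.
Definition lieD X eta : oneform M := 
  @mk1form (fun Y => X (eta Y) - eta (vbr X Y)) (lieD_subproof X eta).

Lemma sformE (f : C) r s t : sform (f *: r + s) t = f * sform r t + sform s t.
Proof.
apply/val_inj/funext => p.
by have [qL _ _ _] := qform_axioms G p; exact: qL.
Qed.

Lemma sformC r s : sform r s = sform s r.
Proof.
apply/val_inj/funext => p.
by have [_ qC _ _] := qform_axioms G p; exact: qC.
Qed.

Variable D : courant_data.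

Fact iiH_subproof X Y (f : C) Z Z' :
  Hform D X Y (f *: Z + Z') = f * Hform D X Y Z + Hform D X Y Z'.
Proof. by have [_ _ HL _ _] := Hform_3form D; exact: HL. Qed.
(* i_Y i_X H, <i_X R, r> and <nabla r, s>. *)
Definition iiH X Y : oneform M := @mk1form (Hform D X Y) (iiH_subproof X Y).

Fact iR_subproof X r (f : C) Z Z' :
  sform (Rform D X (f *: Z + Z')) r =
  f * sform (Rform D X Z) r + sform (Rform D X Z') r.
Proof. by have [_ RL _] := Rform_2form D; rewrite RL sformE. Qed.
Definition iR X r : oneform M :=
  @mk1form (fun Z => sform (Rform D X Z) r) (iR_subproof X r).

Fact nablaform_subproof r s (f : C) Z Z' :
  sform (conn D (f *: Z + Z') r) s =
  f * sform (conn D Z r) s + sform (conn D Z' r) s.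
Proof. by have [cL _ _] := conn_connection D; rewrite cL sformE. Qed.
Definition nablaform r s : oneform M :=
  @mk1form (fun Z => sform (conn D Z r) s) (nablaform_subproof r s).

(* The sections of TM + T*M + G. *)
Definition Esec : Type := (vf M * oneform M * Gsec)%type.
HB.instance Definition _ := GRing.Lmodule.on Esec.

Definition ET (u : Esec) : vf M := u.1.1.
Definition ETs (u : Esec) : oneform M := u.1.2.
Definition EG (u : Esec) : Gsec := u.2.
Definition inT X : Esec := (X, 0, 0).
Definition inTs xi : Esec := (0, xi, 0).
Definition inG r : Esec := (0, 0, r).

Definition Epair (u v : Esec) : C :=
  2^-1 *: (ETs v (ET u) + ETs u (ET v)) + sform (EG u) (EG v).

(* The brackets of two components are
     [X, Y] = L_X Y + i_Y i_X H + R(X, Y),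
     [X, s] = - 2 <i_X R, s> + nabla_X s,
     [r, s] = 2 <nabla r, s> + [r, s]_G,
     [X, eta] = L_X eta,  [xi, eta] = [r, eta] = 0,
   the remaining ones being forced by [u, v] + [v, u] = 2 d <u, v>
   (dorfman_sym):
     [xi, Y] = - L_Y xi + d (xi(Y)),  [r, Y] = 2 <i_Y R, r> - nabla_Y r,
     [xi, s] = 0. *)
Definition dorfman (u v : Esec) : Esec :=
  let: (X, xi, r) := u in let: (Y, eta, s) := v in
  (vbr X Y,
   iiH X Y + lieD X eta - lieD Y xi + dfun (xi Y)
     - iR X s *+ 2 + iR Y r *+ 2 + nablaform r s *+ 2,
   Rform D X Y + conn D X s - conn D Y r + slie r s).

Lemma dorfman_sym (u v : Esec) :
  dorfman u v + dorfman v u = inTs (dfun (Epair u v)) *+ 2.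
Proof.
case: u v => [[X xi] r] [[Y eta] s].
have [HL1 HL2 _ HA _] := Hform_3form D.
have [RL1 RL2 RA] := Rform_2form D.
have HE Z : Hform D Y X Z = - Hform D X Y Z.
  apply/eqP; rewrite -addr_eq0; apply/eqP.
  have := HA (1 *: X + Y) Z.
  by rewrite HL1 !HL2 !HA !scale1r add0r addr0 addrC.
have RE : Rform D Y X = - Rform D X Y.
  apply/eqP; rewrite -addr_eq0; apply/eqP.
  have := RA (1 *: X + Y).
  by rewrite RL1 !RL2 !RA !scale1r add0r addr0 addrC.
have LE : slie s r = - slie r s.
  apply: sect_eq => p; apply/eqP; rewrite -addr_eq0; apply/eqP => /=.
  have [LL1 LL2 LA _] := lie_axioms G p.
  have := LA (1 *: r p + s p).
  by rewrite LL1 !LL2 !LA !scale1r add0r addr0 addrC.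
rewrite mulr2n; congr (_, _, _).
- rewrite addr0; apply/val_inj/funext => f.
  have -> : val (vbr X Y + vbr Y X) f = (X (Y f) - Y (X f)) + (Y (X f) - X (Y f)).
    by [].
  by rewrite addrC subrKA subrr.
- apply/val_inj/funext => Z.
  have [ZD ZZ _] := vf_derivation Z.
  rewrite -mulr2n.
  have -> : val (dfun (Epair (X, xi, r) (Y, eta, s)) *+ 2) Z =
    Z (2^-1 *: (eta X + xi Y) + sform r s) *+ 2 by [].
  rewrite ZD ZZ ZD (conn_form D) (sformC r (conn D Z s)) mulrnDl.
  have half (a : C) : (2^-1 *: a) *+ 2 = a.
    by rewrite -[X in X = _]scaler_nat scalerA divff ?pnatr_eq0// scale1r.
  rewrite half.
  transitivity (
    (Hform D X Y Z + (X (eta Z) - eta (vbr X Z)) - (Y (xi Z) - xi (vbr Y Z))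
     + Z (xi Y) - sform (Rform D X Z) s *+ 2 + sform (Rform D Y Z) r *+ 2
     + sform (conn D Z r) s *+ 2) +
    (Hform D Y X Z + (Y (xi Z) - xi (vbr Y Z)) - (X (eta Z) - eta (vbr X Z))
     + Z (eta X) - sform (Rform D Y Z) r *+ 2 + sform (Rform D X Z) s *+ 2
     + sform (conn D Z s) r *+ 2)); first by [].
  by rewrite HE; ring.
- rewrite [RHS]addr0.
  transitivity (Rform D X Y + conn D X s - conn D Y r + slie r s +
    (Rform D Y X + conn D Y r - conn D X s + slie s r)); first by [].
  rewrite RE LE.
  have -> : - Rform D X Y + conn D Y r - conn D X s - slie r s =
    - (Rform D X Y + conn D X s - conn D Y r + slie r s).
    by rewrite !opprD opprK; congr (_ - _); exact: addrAC.
  by rewrite subrr.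
Qed.

Lemma oneform0 xi : xi 0 = 0.
Proof. by have := oneformP xi (-1) 0 0; rewrite scaler0 addr0 mulN1r addNr. Qed.

Lemma sform0r r : sform r 0 = 0.
Proof.
have := sformE (-1) 0 0 r; rewrite scaler0 addr0 mulN1r addNr => <-.
by rewrite sformC.
Qed.

End Calculus.
Arguments inT {R n M k G}.
Arguments inTs {R n M k G}.
Arguments inG {R n M k G}.

Section Complexification.
Context {V : zmodType}.

(* (a, b) stands for a + i b. *)
Definition cplx : Type := (V * V)%type.

Definition mulci (z : cplx) : cplx := (- z.2, z.1).

Definition cplx_map (f : V -> V) (z : cplx) : cplx := (f z.1, f z.2).

Definition cplx_br (br : V -> V -> V) (z w : cplx) : cplx :=
  (br z.1 w.1 - br z.2 w.2, br z.1 w.2 + br z.2 w.1).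

Definition eigen_i (f : V -> V) (z : cplx) : Prop := cplx_map f z = mulci z.

Definition eigen_i_closed (f : V -> V) (br : V -> V -> V) : Prop :=
  forall z w, eigen_i f z -> eigen_i f w -> eigen_i f (cplx_br br z w).

End Complexification.

Section GeneralisedComplex.
Context {R : realType} {n : nat} {M : manifold R n} {k : nat}.
Context {G : quad_lie_bundle M k}.
Implicit Types (X Y Z : vf M) (r s : sect G) (xi eta : oneform M).

Definition gen_almost_complex (JJ : Esec G -> Esec G) : Prop :=
  (forall u v, Epair (JJ u) v = - Epair u (JJ v)) /\
  (forall u, JJ (JJ u) = - u).

Definition integrable (D : courant_data G) (JJ : Esec G -> Esec G) : Prop :=
  eigen_i_closed JJ (dorfman D).

Section Components.
Variable JJ : Esec G -> Esec G.

Definition compJ X : vf M := ET (JJ (inT X)).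
Definition compB xi : vf M := ET (JJ (inTs xi)).
Definition compnu xi : sect G := EG (JJ (inTs xi)).
Definition compA r : sect G := EG (JJ (inG r)).
(* nu^* : J r = - nu^* r - mu^* r + A r; see compnusP for the duality with nu. *)
Definition compnus r : vf M := - ET (JJ (inG r)).

Lemma compnusP (skewJ : forall u v, Epair (JJ u) v = - Epair u (JJ v)) xi r :
  xi (compnus r) = sform r (compnu xi) *+ 2.
Proof.
have : 2^-1 *: (xi (ET (JJ (inG r))) + oapply (ETs (JJ (inG r))) 0) +
    sform (EG (JJ (inG r))) 0 =
  - (2^-1 *: (oapply (ETs (JJ (inTs xi))) 0 + 0) + sform r (compnu xi)).
  exact: skewJ (inG r) (inTs xi).
rewrite !oneform0 sform0r !addr0 scaler0 add0r => e.
have -> : xi (compnus r) = - xi (ET (JJ (inG r))).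
  by have := oneformP xi (-1) (ET (JJ (inG r))) 0;
    rewrite addr0 oneform0 addr0 mulN1r scaleN1r.
rewrite -[in RHS](opprK (sform _ _)) -e mulNrn; congr (- _).
by rewrite -[RHS]scaler_nat scalerA divff ?pnatr_eq0// scale1r.
Qed.

(* A + nu B^-1 nu^*, with beta = B^-1. *)
Definition tildeA (beta : vf M -> oneform M) r : sect G :=
  compA r + compnu (beta (compnus r)).

End Components.

Definition nondegenerate2 (w : vf M -> vf M -> Cinf M) : Prop :=
  forall xi, exists! X, forall Y, w X Y = xi Y.

Definition symplectic (w : vf M -> vf M -> Cinf M) : Prop :=
  [/\ is_2form (w : vf M -> vf M -> (Cinf M)^o), nondegenerate2 w &
      forall X Y Z, d2 w X Y Z = 0].

Definition integrable_complex (A : sect G -> sect G) : Prop :=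
  (forall r, A (A r) = - r) /\
  (forall p : M, eigen_i_closed (endo_at A p) (@lie _ _ _ _ G p)).

Definition twisted_conn (D : courant_data G) (sigma : vf M -> sect G) X s :=
  conn D X s + slie (sigma X) s.

Definition formBJ (beta : vf M -> oneform M) (J : vf M -> vf M) X Y : Cinf M :=
  - (2^-1 *: (beta (J X) Y + beta X (J Y))).

(* Multiplication by a real constant. *)
Definition rscale (c : R) s : sect G := (c *: (1 : Cinf M)) *: s.

End GeneralisedComplex.

(* Main.v *)
Require Import Defs.
From mathcomp Require Import all_boot all_order all_algebra ring.
From mathcomp Require Import mathcomp_extra boolp classical_sets functions.
From mathcomp Require Import interval_inference reals topology normedtype.
From mathcomp Require Import derive sequences exp.

(** The idea is to replace the splitting E = TM + T*M + G by one in which JJ is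
    as simple as possible. Write sigma = nu B^-1. The isotropic bundle T*M and
    its image JJ(T*M) are dual to each other, because B is invertible, and the
    orthogonal complement of their sum is a JJ-invariant copy of G. Concretely

      frameT X = JJ (B^-1 X) = X + theta X + sigma X,
      frameG r = r - 2 <sigma, r>,

    and JJ (frameG r) = frameG (At r): the endomorphism tilde A of the theorem
    is JJ restricted to that complement ([JJ_frameG]).

    In this frame the Dorfman bracket again has its standard form
    ([dorfman_TT], [dorfman_TG], [dorfman_GG]), for the twisted data

      nabla' = nabla + ad_sigma,
      R' = R + d^nabla sigma + [sigma, sigma],
      H' = twisted_H.

    The i-eigenvectors are the u - i JJ u, so integrability is the vanishing of
    the Nijenhuis tensor

      N(u, v) = JJ([u, v] - [JJ u, JJ v]) - [u, JJ v] - [JJ u, v]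

    ([eigen_i_closedP]). As N(JJ u, v) = - JJ N(u, v), it suffices to evaluate N
    on T*M and on frameG. There

      N(B^-1 X, B^-1 Y) = - d(B^-1)(X, Y, .) - frameT (B H'(X, Y))
                          - frameG (At R'(X, Y)),

    while N(B^-1 X, frameG r) contains nabla' At and N(frameG r, frameG s)
    contains the Nijenhuis tensor N_At of At for the bracket of G. The remaining
    terms vanish if R' = 0 and nabla' At = 0, because At is skew. Hence
    ([integrableP]) JJ is integrable exactly when d(B^-1) = 0, N_At = 0,
    nabla' At = 0, R' = 0 and H' = 0. The first four are conditions 1 to 4. For
    the last, the symmetric part of theta, regarded as a bilinear form, is
    - <sigma, sigma> and its skew part is B_J; differentiating <sigma, sigma>
    with the help of R' = 0 shows that H' is the left-hand side of condition 5
    ([twisted_HE]).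

    Only condition 2 is about fibres instead of sections. Passing between the
    two needs that every vector of a fibre extends to a global section and that
    a C^oo(M)-linear map acts fibre by fibre ([exists_section], [tensorial]);
    both follow from smooth cutoff functions, built from exp(-1/x). *)

Set Implicit Arguments.
Unset Strict Implicit.
Unset Printing Implicit Defensive.

Import GRing.Theory.
Local Open Scope ring_scope.

(** * The Nijenhuis tensor of a bracket *)

Lemma morphD0 (V W : zmodType) (f : V -> W) :
  {morph f : x y / x + y} -> f 0 = 0.
Proof. by move=> fD; apply: (addrI (f 0)); rewrite -fD !addr0. Qed.

Lemma morphDN (V W : zmodType) (f : V -> W) :
  {morph f : x y / x + y} -> {morph f : x / - x}.
Proof.
by move=> fD x; apply: (addrI (f x)); rewrite -fD !subrr (morphD0 fD).
Qed.

Lemma linear_morphD (S : pzRingType) (U W : lmodType S) (f : U -> W) :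
  (forall a x y, f (a *: x + y) = a *: f x + f y) -> {morph f : x y / x + y}.
Proof. by move=> fP x y; have := fP 1 x y; rewrite !scale1r. Qed.

Section Nijenhuis.
Context {V : zmodType}.
Implicit Types (J : V -> V) (br : V -> V -> V).

Definition nijenhuis J br u v : V :=
  J (br u v - br (J u) (J v)) - (br u (J v) + br (J u) v).

(** An i-eigenvector is determined by its real part u: it is (u, - J u), that is
    u - i J u. The bracket of two of them is again an eigenvector iff one real
    equation holds, the imaginary part of the condition being J applied to the
    real one. *)
Lemma eigen_i_closedP J br :
    {morph J : u / - u} -> (forall u, J (J u) = - u) ->
    (forall v, {morph br^~ v : u / - u}) ->
    (forall u, {morph br u : v / - v}) ->
  eigen_i_closed J br <-> forall u v, nijenhuis J br u v = 0.
Proof.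
move=> JN J2 brNl brNr; have ei u : eigen_i J (u, - J u).
  by rewrite /eigen_i/cplx_map/mulci/= opprK JN J2 opprK.
split=> [cl u v|N0 [u u'] [v v'] [Ju Ju'] [Jv Jv']].
  have [+ _] := cl _ _ (ei u) (ei v).
  rewrite /cplx_br/= brNl !brNr brNl opprK opprD !opprK => e.
  by rewrite /nijenhuis e subrr.
have {Ju} -> : u' = - J u by rewrite Ju opprK.
have {Jv} -> : v' = - J v by rewrite Jv opprK.
have e := N0 u v; move/eqP: e; rewrite subr_eq0 => /eqP e.
rewrite /eigen_i/cplx_map/mulci /cplx_br/= brNl !brNr brNl opprK -opprD.
by rewrite opprK JN -e J2 opprK.
Qed.

Section Additive.
Variables (J : {additive V -> V}) (br : V -> V -> V).
Hypothesis J2 : forall u, J (J u) = - u.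
Hypothesis brDl : forall v, {morph br^~ v : u w / u + w}.
Hypothesis brDr : forall u, {morph br u : v w / v + w}.

Lemma nijenhuisDl v : {morph nijenhuis J br ^~ v : u w / u + w}.
Proof.
move=> u w; rewrite /nijenhuis (raddfD J u w) !brDl !opprD.
by rewrite [X in J X]addrACA raddfD [X in _ + X]addrACA [LHS]addrACA.
Qed.

Lemma nijenhuisDr u : {morph nijenhuis J br u : v w / v + w}.
Proof.
move=> v w; rewrite /nijenhuis (raddfD J v w) !brDr !opprD.
by rewrite [X in J X]addrACA raddfD [X in _ + X]addrACA [LHS]addrACA.
Qed.

Let brNl v : {morph br^~ v : u / - u}.
Proof. exact: morphDN. Qed.

Let brNr u : {morph br u : v / - v}.
Proof. exact: morphDN. Qed.

(** With the next lemma: the vanishing of the tensor on a subspace S propagates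
    to S + J S, without any tensoriality over functions. *)
Lemma nijenhuisJl u v : nijenhuis J br (J u) v = - J (nijenhuis J br u v).
Proof.
rewrite /nijenhuis J2 !brNl opprK (raddfB J (J _)) J2 [RHS]opprB opprK opprB.
by rewrite [X in J X]addrC.
Qed.

Lemma nijenhuisJr u v : nijenhuis J br u (J v) = - J (nijenhuis J br u v).
Proof.
rewrite /nijenhuis J2 !brNr opprK (raddfB J (J _)) J2 [RHS]opprB opprK.
by rewrite opprD opprK [X in _ + X]addrC.
Qed.

End Additive.
End Nijenhuis.

(** * Linearity of the operations of the Courant algebroid *)

Section CourantCalculus.
Context {R : realType} {n : nat} {M : manifold R n} {k : nat}.
Context {G : quad_lie_bundle M k} (D : courant_data G).
Implicit Types (f g : Cinf M) (X Y Z : vf M) (r s t : sect G).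
Implicit Types (xi eta : oneform M).

Lemma oneform_eq xi eta : (forall Z, xi Z = eta Z) -> xi = eta.
Proof. by move=> e; apply/val_inj/funext. Qed.

Lemma Cinf_half f : (2^-1 *: f) *+ 2 = f.
Proof.
by rewrite -[X in X = _]scaler_nat scalerA divff ?pnatr_eq0// scale1r.
Qed.

Lemma Cinf_double_eq0 f : f *+ 2 = 0 -> f = 0.
Proof. by move=> f2; rewrite -[LHS]Cinf_half scalerMnr f2 scaler0. Qed.

Lemma vappD X f g : X (f + g) = X f + X g.
Proof. by have [XD _ _] := vf_derivation X; exact: XD. Qed.

Lemma vapp0r X : X 0 = 0.
Proof. exact: morphD0 (vappD X). Qed.

Lemma vapp0l f : (0 : vf M) f = 0.
Proof. by []. Qed.

Lemma vappN X f : X (- f) = - X f.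
Proof. exact: morphDN (vappD X) f. Qed.

Lemma vappMn X f m : X (f *+ m) = X f *+ m.
Proof. by elim: m => [|m IH]; rewrite ?mulr0n ?vapp0r// !mulrS vappD IH. Qed.

Lemma oneformD xi X Y : xi (X + Y) = xi X + xi Y.
Proof. by have := oneformP xi 1 X Y; rewrite scale1r mul1r. Qed.

Lemma oneformN xi X : xi (- X) = - xi X.
Proof. exact: morphDN (oneformD xi) X. Qed.

Lemma vf_ext X Y : (forall f, X f = Y f) -> X = Y.
Proof. by move=> e; apply/val_inj/funext. Qed.

Lemma vbr_skew X Y : vbr Y X = - vbr X Y.
Proof.
apply: vf_ext => f; change (Y (X f) - X (Y f) = - (X (Y f) - Y (X f))).
by rewrite opprB.
Qed.

Lemma vbrDr X Y Z : vbr X (Y + Z) = vbr X Y + vbr X Z.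
Proof.
apply: vf_ext => f.
change (X (Y f + Z f) - (Y (X f) + Z (X f)) =
  X (Y f) - Y (X f) + (X (Z f) - Z (X f))).
by rewrite vappD opprD addrACA.
Qed.

Lemma vbrDl X Y Z : vbr (X + Y) Z = vbr X Z + vbr Y Z.
Proof. by rewrite vbr_skew vbrDr opprD -!vbr_skew. Qed.

Lemma vbr0r X : vbr X 0 = 0.
Proof. exact: morphD0 (vbrDr X). Qed.

Lemma vbr0l X : vbr 0 X = 0.
Proof. by rewrite vbr_skew vbr0r oppr0. Qed.

Lemma sformDl r s t : sform (r + s) t = sform r t + sform s t.
Proof. by have := sformE 1 r s t; rewrite scale1r mul1r. Qed.

Lemma sformDr r s t : sform t (r + s) = sform t r + sform t s.
Proof. by rewrite sformC sformDl !(sformC t). Qed.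

Lemma sform0l r : sform 0 r = 0.
Proof. by rewrite sformC sform0r. Qed.

Lemma sformNl r s : sform (- r) s = - sform r s.
Proof. exact: morphDN (fun r' s' => sformDl r' s' s) r. Qed.

Lemma sformNr r s : sform r (- s) = - sform r s.
Proof. by rewrite sformC sformNl sformC. Qed.

Lemma sformZl f r s : sform (f *: r) s = f * sform r s.
Proof. by have := sformE f r 0 s; rewrite sform0l !addr0. Qed.

Lemma sform_ad r s t : sform (slie r s) t = sform r (slie s t).
Proof.
by apply/val_inj/funext => p; have [_ _ _ qA] := qform_axioms G p; exact: qA.
Qed.

Lemma slieDl r s t : slie (r + s) t = slie r t + slie s t.
Proof.
apply: sect_eq => p; have [L _ _ _] := lie_axioms G p.
by have := L 1 (r p) (s p) (t p); rewrite !scale1r.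
Qed.

Lemma slieDr r s t : slie t (r + s) = slie t r + slie t s.
Proof.
apply: sect_eq => p; have [_ L _ _] := lie_axioms G p.
by have := L 1 (t p) (r p) (s p); rewrite !scale1r.
Qed.

Lemma slie_skew r s : slie s r = - slie r s.
Proof.
have lxx t : slie t t = 0.
  by apply: sect_eq => p; have [_ _ L _] := lie_axioms G p; exact: L.
by apply/eqP; rewrite -addr_eq0; have := lxx (r + s);
  rewrite slieDl !slieDr !lxx add0r addr0 addrC => ->.
Qed.

Lemma slie0r r : slie r 0 = 0.
Proof. exact: morphD0 (fun s t => slieDr s t r). Qed.

Lemma connDl X Y s : conn D (X + Y) s = conn D X s + conn D Y s.
Proof.
by have [L _ _] := conn_connection D; have := L 1 X Y s; rewrite !scale1r.
Qed.

Lemma connDr X r s : conn D X (r + s) = conn D X r + conn D X s.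
Proof. by have [_ L _] := conn_connection D; exact: L. Qed.

Lemma conn0l s : conn D 0 s = 0.
Proof. exact: morphD0 (fun X Y => connDl X Y s). Qed.

Lemma conn0r X : conn D X 0 = 0.
Proof. exact: morphD0 (connDr X). Qed.

Lemma RformDl X Y Z : Rform D (X + Y) Z = Rform D X Z + Rform D Y Z.
Proof.
by have [L _ _] := Rform_2form D; have := L 1 X Y Z; rewrite !scale1r.
Qed.

Lemma RformDr X Y Z : Rform D Z (X + Y) = Rform D Z X + Rform D Z Y.
Proof.
by have [_ L _] := Rform_2form D; have := L 1 Z X Y; rewrite !scale1r.
Qed.

Lemma Rform0r X : Rform D X 0 = 0.
Proof. exact: morphD0 (fun Y Z => RformDr Y Z X). Qed.

Lemma Rform0l X : Rform D 0 X = 0.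
Proof. exact: morphD0 (fun Y Z => RformDl Y Z X). Qed.

Lemma Rform_skew X Y : Rform D Y X = - Rform D X Y.
Proof.
have [_ _ A] := Rform_2form D.
by apply/eqP; rewrite -addr_eq0; have := A (X + Y);
  rewrite RformDl !RformDr !A add0r addr0 addrC => ->.
Qed.

Lemma HformDm X Y Z V : Hform D Z (X + Y) V = Hform D Z X V + Hform D Z Y V.
Proof.
by have [_ L _ _ _] := Hform_3form D; have := L 1 Z X Y V; rewrite !scale1r.
Qed.

Lemma Hform0m X Y : Hform D X 0 Y = 0.
Proof. exact: morphD0 (fun Z V => HformDm Z V X Y). Qed.

Lemma Esec_eq (u v : Esec G) :
  ET u = ET v -> (forall Z, ETs u Z = ETs v Z) -> EG u = EG v -> u = v.
Proof.
case: u v => [[X xi] r] [[Y eta] s]; rewrite /ET/ETs/EG/= => -> e ->.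
by congr (_, _, _); exact: oneform_eq.
Qed.

Lemma ET_dorfman u v : ET (dorfman D u v) = vbr (ET u) (ET v).
Proof. by case: u v => [[X xi] r] [[Y eta] s]. Qed.

Lemma EG_dorfman u v : EG (dorfman D u v) =
  Rform D (ET u) (ET v) + conn D (ET u) (EG v) - conn D (ET v) (EG u)
  + slie (EG u) (EG v).
Proof. by case: u v => [[X xi] r] [[Y eta] s]. Qed.

Lemma ETs_dorfman u v Z : ETs (dorfman D u v) Z =
  Hform D (ET u) (ET v) Z
  + (ET u (ETs v Z) - ETs v (vbr (ET u) Z))
  - (ET v (ETs u Z) - ETs u (vbr (ET v) Z))
  + Z (ETs u (ET v))
  - sform (Rform D (ET u) Z) (EG v) *+ 2 + sform (Rform D (ET v) Z) (EG u) *+ 2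
  + sform (conn D Z (EG u)) (EG v) *+ 2.
Proof. by case: u v => [[X xi] r] [[Y eta] s]. Qed.

Lemma dorfmanDr u v w : dorfman D u (v + w) = dorfman D u v + dorfman D u w.
Proof.
apply: Esec_eq => [|Z|].
- change (ET (dorfman D u (v + w)) = ET (dorfman D u v) + ET (dorfman D u w)).
  by rewrite !ET_dorfman -vbrDr.
- change (ETs (dorfman D u (v + w)) Z =
    ETs (dorfman D u v) Z + ETs (dorfman D u w) Z).
  rewrite !ETs_dorfman.
  have -> : ET (v + w) = ET v + ET w by [].
  have -> : EG (v + w) = EG v + EG w by [].
  have e Z' : ETs (v + w) Z' = ETs v Z' + ETs w Z' by [].
  have vE f : (ET v + ET w) f = ET v f + ET w f by [].
  rewrite !e !vE HformDm !vappD vbrDl !oneformD !vappD RformDl sformDl !sformDr.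
  by ring.
- change (EG (dorfman D u (v + w)) = EG (dorfman D u v) + EG (dorfman D u w)).
  rewrite !EG_dorfman.
  have -> : ET (v + w) = ET v + ET w by [].
  have -> : EG (v + w) = EG v + EG w by [].
  rewrite RformDr connDr connDl slieDr opprD.
  by rewrite (addrACA (Rform _ _ _)) [X in X + _ = _]addrACA [LHS]addrACA.
Qed.

Lemma EpairDl (u v w : Esec G) : Epair (u + v) w = Epair u w + Epair v w.
Proof.
case: u v w => [[X xi] r] [[Y eta] s] [[Z zeta] t].
change (2^-1 *: (zeta (X + Y) + (xi Z + eta Z)) + sform (r + s) t =
  2^-1 *: (zeta X + xi Z) + sform r t + (2^-1 *: (zeta Y + eta Z) + sform s t)).
by rewrite oneformD sformDl addrACA scalerDr addrACA.
Qed.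

Lemma dfunD f g : dfun (f + g) = dfun f + dfun g.
Proof. by apply: oneform_eq => Z; exact: vappD. Qed.

Lemma inTsD xi eta : inTs (xi + eta) = inTs xi + inTs eta :> Esec G.
Proof.
change ((0, xi + eta, 0) = (0 + 0, xi + eta, 0 + 0) :> Esec G).
by rewrite !addr0.
Qed.

(** The symmetric part of the bracket is d of the pairing, so additivity on the
    left follows from additivity on the right. *)
Lemma dorfmanDl u v w : dorfman D (u + v) w = dorfman D u w + dorfman D v w.
Proof.
have E (u' v' : Esec G) :
    dorfman D u' v' = inTs (dfun (Epair u' v')) *+ 2 - dorfman D v' u'.
  by rewrite -(dorfman_sym D) addrK.
rewrite (E (u + v) w) (E u w) (E v w) dorfmanDr EpairDl dfunD inTsD.
rewrite mulrnDl opprD.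
exact: addrACA.
Qed.

End CourantCalculus.

(** * The frame adapted to a non-degenerate structure *)

Section NormalForm.
Context {R : realType} {n : nat} {M : manifold R n} {k : nat}.
Context {G : quad_lie_bundle M k} (D : courant_data G).
Variables (JJ : {linear Esec G -> Esec G}) (Binv : vf M -> oneform M).
Hypothesis JJ_gacs : gen_almost_complex JJ.
Hypothesis BK : cancel (compB JJ) Binv.
Hypothesis BinvK : cancel Binv (compB JJ).
Implicit Types (f g : Cinf M) (X Y Z : vf M) (r s t : sect G).
Implicit Types (xi eta : oneform M).

Local Notation B := (compB JJ).
Local Notation At := (tildeA JJ Binv).
Local Notation sigma := (fun X => compnu JJ (Binv X)).

(** The isotropic lifts of vector fields that span JJ(T*M), and the elements of
    the orthogonal complement of T*M + JJ(T*M), parametrised by their component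
    in G. *)
Definition frameT X : Esec G := JJ (inTs (Binv X)).
Definition frameG r : Esec G := inG r + inTs (Binv (compnus JJ r)).

(** As a bilinear form this is B_J - <sigma, sigma>. *)
Definition theta X : oneform M := ETs (frameT X).

Let skew u v : Epair (JJ u) v = - Epair u (JJ v).
Proof. by have [] := JJ_gacs. Qed.

Let JJ2 u : JJ (JJ u) = - u.
Proof. by have [] := JJ_gacs. Qed.

Lemma inTs_linear f xi eta :
  inTs (f *: xi + eta) = f *: inTs xi + inTs eta :> Esec G.
Proof.
change ((0, f *: xi + eta, 0) =
  (f *: 0 + 0, f *: xi + eta, f *: 0 + 0) :> Esec G).
by rewrite !scaler0 !addr0.
Qed.

Lemma inG_linear f r s : inG (f *: r + s) = f *: inG r + inG s :> Esec G.
Proof.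
change ((0, 0, f *: r + s) = (f *: 0 + 0, f *: 0 + 0, f *: r + s) :> Esec G).
by rewrite !scaler0 !addr0.
Qed.

Lemma compB_linear f xi eta : B (f *: xi + eta) = f *: B xi + B eta.
Proof. by rewrite /compB inTs_linear linearP. Qed.

Lemma Binv_linear f X Y : Binv (f *: X + Y) = f *: Binv X + Binv Y.
Proof. by rewrite -[X in LHS]BinvK -[Y in LHS]BinvK -compB_linear BK. Qed.

(** Skew-symmetry of JJ, tested on two one-forms. *)
Lemma Binv_skew X Y : Binv Y X = - Binv X Y.
Proof.
have e : 2^-1 *: (Binv Y (B (Binv X)) + theta X 0) + sform (sigma X) 0 =
    - (2^-1 *: (theta Y 0 + Binv X (B (Binv Y))) + sform 0 (sigma Y)).
  exact: skew (inTs (Binv X)) (inTs (Binv Y)).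
rewrite !BinvK !oneform0 sform0r sform0l !addr0 add0r in e.
by rewrite -[LHS]Cinf_half e mulNrn Cinf_half.
Qed.

Lemma Binv_symplectic (dw : forall X Y Z, d2 (fun X Y => Binv X Y) X Y Z = 0) :
  symplectic (fun X Y => Binv X Y).
Proof.
split=> //; first split=> [f X Y Z|f X Y Z|X].
- by rewrite Binv_linear.
- exact: oneformP.
- by apply: Cinf_double_eq0; rewrite mulr2n {1}Binv_skew addNr.
- move=> xi; exists (B xi); split=> [Y|X eX]; first by rewrite BK.
  by rewrite -[RHS]BinvK; congr B; apply: oneform_eq => Y; rewrite eX.
Qed.

Lemma ET_frameT X : ET (frameT X) = X.
Proof. exact: BinvK. Qed.

Lemma EG_frameT X : EG (frameT X) = sigma X.
Proof. by []. Qed.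

Lemma ET_frameG r : ET (frameG r) = 0.
Proof. by change (0 + 0 = 0 :> vf M); rewrite addr0. Qed.

Lemma EG_frameG r : EG (frameG r) = r.
Proof. by change (r + 0 = r); rewrite addr0. Qed.

Lemma ETs_frameG r Z : ETs (frameG r) Z = - (sform (sigma Z) r *+ 2).
Proof.
change (ETs (frameG r) Z) with (0 + Binv (compnus JJ r) Z).
by rewrite add0r Binv_skew compnusP// sformC.
Qed.

Lemma thetaE X Y : theta X Y = - Binv X (compJ JJ Y).
Proof.
have e : 2^-1 *: (oapply 0 (B (Binv X)) + theta X Y) + sform (sigma X) 0 =
    - (2^-1 *: (ETs (JJ (inT Y)) 0 + Binv X (compJ JJ Y))
       + sform 0 (EG (JJ (inT Y)))).
  exact: skew (inTs (Binv X)) (inT Y).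
rewrite !oneform0 sform0r sform0l !addr0 !add0r in e.
by rewrite -[LHS]Cinf_half e mulNrn Cinf_half.
Qed.

(** The lifts are isotropic, because JJ is orthogonal and T*M is isotropic; this
    fixes the symmetric part of theta. *)
Lemma theta_swap X Y : theta Y X = - theta X Y - sform (sigma X) (sigma Y) *+ 2.
Proof.
have e : Epair (frameT X) (frameT Y) = 0.
  rewrite skew JJ2.
  change (- (2^-1 *: (- Binv Y 0 + Binv X (-0))
    + sform (0 : sect G) (- 0)) = 0).
  by rewrite !oppr0 !oneform0 sform0r !oppr0 !addr0 scaler0 !oppr0.
have e2 : (2^-1 *: (theta Y X + theta X Y)
    + sform (sigma X) (sigma Y)) *+ 2 = 0.
  by rewrite -[RHS](mul0rn _ 2) -e /Epair !ET_frameT.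
rewrite mulrnDl Cinf_half -addrA in e2.
by rewrite -opprD; apply/eqP; rewrite -addr_eq0; exact/eqP.
Qed.

Lemma JJ_frameT X : JJ (frameT X) = - inTs (Binv X).
Proof. exact: JJ2. Qed.

Lemma JJ_inTs xi : JJ (inTs xi) = frameT (B xi).
Proof. by rewrite /frameT BK. Qed.

Lemma EG_JJ_frameG r : EG (JJ (frameG r)) = At r.
Proof. by rewrite /frameG linearD. Qed.

(** JJ is orthogonal and preserves T*M + JJ(T*M), hence also the orthogonal
    complement. Concretely, the tangent component of the left-hand side vanishes
    because B inverts B^-1, the component in G is the definition of tilde A, and
    the cotangent component is then forced by orthogonality to JJ(T*M). *)
Lemma JJ_frameG r : JJ (frameG r) = frameG (At r).
Proof.
have T0 : ET (JJ (frameG r)) = 0.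
  rewrite /frameG linearD.
  change (ET (JJ (inG r)) + B (Binv (compnus JJ r)) = 0).
  by rewrite BinvK /compnus subrr.
apply: Esec_eq => [|Z|].
- by rewrite T0 ET_frameG.
- have e : Epair (JJ (frameG r)) (frameT Z) = 0.
    rewrite skew JJ_frameT.
    change (- (2^-1 *: (- Binv Z (ET (frameG r)) + ETs (frameG r) (-0))
      + sform (EG (frameG r)) (-0)) = 0).
    rewrite ET_frameG !oppr0 !oneform0 sform0r oppr0 !addr0 scaler0.
    by rewrite oppr0.
  have e2 : (2^-1 *: (theta Z 0 + ETs (JJ (frameG r)) Z)
      + sform (At r) (sigma Z)) *+ 2 = 0.
    by rewrite -[RHS](mul0rn _ 2) -e /Epair T0 ET_frameT EG_JJ_frameG.
  rewrite mulrnDl Cinf_half oneform0 add0r in e2.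
  rewrite ETs_frameG sformC; apply/eqP; rewrite -addr_eq0; exact/eqP.
- by rewrite EG_frameG EG_JJ_frameG.
Qed.

Lemma frameG_linear f r s : frameG (f *: r + s) = f *: frameG r + frameG s.
Proof.
rewrite /frameG inG_linear scalerDr addrACA -inTs_linear -Binv_linear.
congr (_ + inTs (Binv _)).
by rewrite /compnus inG_linear linearP opprD scalerN.
Qed.

Lemma frameGD : {morph frameG : r s / r + s}.
Proof. exact: linear_morphD frameG_linear. Qed.

Lemma frameG0 : frameG 0 = 0.
Proof. exact: morphD0 frameGD. Qed.

Lemma frameGN : {morph frameG : r / - r}.
Proof. exact: morphDN frameGD. Qed.

Lemma frameT0 : frameT 0 = 0.
Proof.
rewrite /frameT (morphD0 (linear_morphD Binv_linear)).
by rewrite -[inTs 0]/(0 : Esec G) linear0.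
Qed.

Lemma tildeA_linear f r s : At (f *: r + s) = f *: At r + At s.
Proof. by rewrite -EG_JJ_frameG frameG_linear linearP -!EG_JJ_frameG. Qed.

Lemma tildeA2 r : At (At r) = - r.
Proof. by rewrite -EG_JJ_frameG -JJ_frameG JJ2 -[in RHS](EG_frameG r). Qed.

Lemma tildeAD : {morph At : r s / r + s}.
Proof. exact: linear_morphD tildeA_linear. Qed.

Lemma Epair_frameG r s : Epair (frameG r) (frameG s) = sform r s.
Proof.
by rewrite /Epair !ET_frameG !EG_frameG !oneform0 addr0 scaler0 add0r.
Qed.

Lemma tildeA_skew r s : sform (At r) s = - sform r (At s).
Proof. by rewrite -!Epair_frameG -!JJ_frameG skew. Qed.

Lemma frame_decomp u : exists xi X r, u = inTs xi + frameT X + frameG r.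
Proof.
exists (ETs u - theta (ET u) - ETs (frameG (EG u - sigma (ET u)))), (ET u).
exists (EG u - sigma (ET u)); apply: Esec_eq => [|Z|].
- change (ET u = 0 + ET (frameT (ET u)) + ET (frameG (EG u - sigma (ET u)))).
  by rewrite ET_frameT ET_frameG addr0 add0r.
- set r := EG u - _.
  change (ETs u Z = ETs u Z - theta (ET u) Z - ETs (frameG r) Z + theta (ET u) Z
    + ETs (frameG r) Z).
  by ring.
- change (EG u = 0 + sigma (ET u) + EG (frameG (EG u - sigma (ET u)))).
  by rewrite EG_frameG add0r addrC subrK.
Qed.

Lemma frame_eq0 xi X r : inTs xi + frameT X + frameG r = 0 <->
  [/\ xi = 0, X = 0 & r = 0].
Proof.
split=> [e|[-> -> ->]]; last by rewrite frameT0 frameG0 !addr0.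
have X0 : X = 0.
  have := congr1 (@ET _ _ _ _ _) e.
  change (0 + ET (frameT X) + ET (frameG r) = 0 -> X = 0).
  by rewrite ET_frameT ET_frameG addr0 add0r.
rewrite X0 frameT0 addr0 in e.
have r0 : r = 0.
  have := congr1 (@EG _ _ _ _ _) e.
  by change (0 + EG (frameG r) = 0 -> r = 0); rewrite EG_frameG add0r.
rewrite r0 frameG0 addr0 in e.
by split=> //; exact: (congr1 (@ETs _ _ _ _ _) e).
Qed.

(** * The Dorfman bracket in the adapted frame *)

Local Notation tconn := (twisted_conn D sigma).
Local Notation sigma2 := (fun X Y => slie (sigma X) (sigma Y)).

(** The data (nabla', R', H') of the algebroid in the adapted frame, with the
    one-forms that complete the brackets. Each of these one-forms is taken to be
    the cotangent component of what remains of the bracket, so that it is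
    C^oo(M)-linear by construction; its values are computed afterwards. *)
Definition twisted_R X Y : sect G :=
  dD1 (conn D) sigma X Y + sigma2 X Y + Rform D X Y.

Definition twisted_H X Y : oneform M := ETs
  (dorfman D (frameT X) (frameT Y) - frameT (vbr X Y) - frameG (twisted_R X Y)).

Definition mixed_form X r : oneform M :=
  ETs (dorfman D (frameT X) (frameG r) - frameG (tconn X r)).

Definition vertical_form r s : oneform M :=
  ETs (dorfman D (frameG r) (frameG s) - frameG (slie r s)).

Lemma inTsN xi : inTs (- xi) = - inTs xi :> Esec G.
Proof. exact: morphDN inTsD xi. Qed.

Lemma inTs_ETs (u : Esec G) : ET u = 0 -> EG u = 0 -> u = inTs (ETs u).
Proof. by case: u => [[X xi] r]; rewrite /ET/EG/= => -> ->. Qed.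

Lemma dorfman_TT X Y : dorfman D (frameT X) (frameT Y) =
  frameT (vbr X Y) + frameG (twisted_R X Y) + inTs (twisted_H X Y).
Proof.
rewrite -inTs_ETs.
- by rewrite [RHS]addrC -(addrA (dorfman _ _ _)) -opprD subrK.
- change (ET (dorfman D (frameT X) (frameT Y)) - ET (frameT (vbr X Y))
    - ET (frameG (twisted_R X Y)) = 0).
  by rewrite ET_dorfman !ET_frameT ET_frameG subrr subr0.
- change (EG (dorfman D (frameT X) (frameT Y)) - EG (frameT (vbr X Y))
    - EG (frameG (twisted_R X Y)) = 0).
  rewrite EG_dorfman !ET_frameT EG_frameG !EG_frameT /twisted_R /dD1.
  set a := Rform _ _ _; set b := conn _ _ _; set c := conn _ _ _.
  set d := compnu _ _; set e := slie _ _.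
  apply/eqP; rewrite subr_eq0; apply/eqP.
  by rewrite -!addrA [LHS]addrC -!addrA [X in _ + (_ + X) = _]addrCA.
Qed.

Lemma dorfman_TG X r : dorfman D (frameT X) (frameG r) =
  frameG (tconn X r) + inTs (mixed_form X r).
Proof.
rewrite -inTs_ETs; first by rewrite addrC subrK.
- change (ET (dorfman D (frameT X) (frameG r)) - ET (frameG (tconn X r)) = 0).
  by rewrite ET_dorfman !ET_frameG vbr0r subr0.
- change (EG (dorfman D (frameT X) (frameG r)) - EG (frameG (tconn X r)) = 0).
  rewrite EG_dorfman !EG_frameG ET_frameG ET_frameT Rform0r conn0l.
  by rewrite add0r subr0 EG_frameT subrr.
Qed.

Lemma dorfman_GG r s : dorfman D (frameG r) (frameG s) =
  frameG (slie r s) + inTs (vertical_form r s).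
Proof.
rewrite -inTs_ETs; first by rewrite addrC subrK.
- change (ET (dorfman D (frameG r) (frameG s)) - ET (frameG (slie r s)) = 0).
  by rewrite ET_dorfman !ET_frameG vbr0r subr0.
- change (EG (dorfman D (frameG r) (frameG s)) - EG (frameG (slie r s)) = 0).
  rewrite EG_dorfman !EG_frameG !ET_frameG Rform0r !conn0l.
  by rewrite subr0 !add0r subrr.
Qed.

Lemma Epair_TG X r : Epair (frameT X) (frameG r) = 0.
Proof.
rewrite /Epair ET_frameG ET_frameT ETs_frameG oneform0 EG_frameG EG_frameT.
rewrite addr0.
apply: Cinf_double_eq0.
by rewrite mulrnDl Cinf_half addNr.
Qed.

Lemma dorfman_GT X r : dorfman D (frameG r) (frameT X) =
  - dorfman D (frameT X) (frameG r).
Proof.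
apply/eqP; rewrite -addr_eq0 addrC dorfman_sym Epair_TG; apply/eqP.
have -> : dfun (0 : Cinf M) = 0 by apply: oneform_eq => Z; rewrite /= vapp0r.
by rewrite -[inTs 0]/(0 : Esec G) mul0rn.
Qed.

Lemma dorfman_TTs X eta : dorfman D (frameT X) (inTs eta) = inTs (lieD X eta).
Proof.
apply: Esec_eq => [|Z|].
- by rewrite ET_dorfman vbr0r.
- rewrite ETs_dorfman ET_frameT.
  change (Hform D X 0 Z + lieD X eta Z - (0 - theta X (vbr 0 Z)) + Z (theta X 0)
    - sform (Rform D X Z) (0 : sect G) *+ 2 + sform (Rform D 0 Z) (sigma X) *+ 2
    + sform (conn D Z (sigma X)) 0 *+ 2 = lieD X eta Z).
  rewrite Hform0m vbr0l !oneform0 vapp0r !sform0r Rform0l sform0l.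
  by rewrite !mul0rn !subr0 !addr0 add0r.
- change (EG (inTs (lieD X eta))) with (0 : sect G).
  rewrite EG_dorfman; change (ET (inTs eta)) with (0 : vf M).
  change (EG (inTs eta)) with (0 : sect G).
  by rewrite Rform0r conn0r conn0l slie0r !addr0 subr0.
Qed.

Lemma dorfman_TsT X eta : dorfman D (inTs eta) (frameT X) =
  inTs (dfun (eta X) - lieD X eta).
Proof.
have := dorfman_sym D (inTs eta) (frameT X).
rewrite dorfman_TTs => /(canRL (addrK _)) ->.
have -> : Epair (inTs eta) (frameT X) = 2^-1 *: eta X.
  rewrite /Epair ET_frameT.
  rewrite -[ET (inTs eta)]/(0 : vf M) -[EG (inTs eta)]/(0 : sect G).
  by rewrite oneform0 sform0l addr0 add0r.
have e : dfun (2^-1 *: eta X) *+ 2 = dfun (eta X).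
  apply: oneform_eq => Z.
  change (Z (2^-1 *: eta X) *+ 2 = Z (eta X)).
  by rewrite -vappMn Cinf_half.
by rewrite -inTsN mulr2n -!inTsD -mulr2n e.
Qed.

Lemma dorfman_GTs r eta : dorfman D (frameG r) (inTs eta) = 0.
Proof.
apply: Esec_eq => [|Z|].
- by rewrite ET_dorfman vbr0r.
- rewrite ETs_dorfman ET_frameG.
  change (Hform D 0 0 Z + (0 - eta (vbr 0 Z)) - (0 - ETs (frameG r) (vbr 0 Z))
    + Z (ETs (frameG r) 0)
    - sform (Rform D 0 Z) (0 : sect G) *+ 2
    + sform (Rform D 0 Z) (EG (frameG r)) *+ 2
    + sform (conn D Z (EG (frameG r))) 0 *+ 2 = 0).
  rewrite Hform0m vbr0l !oneform0 vapp0r !sform0r Rform0l sform0l.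
  by rewrite !mul0rn !subr0 !addr0.
- rewrite EG_dorfman ET_frameG.
  rewrite -[ET (inTs eta)]/(0 : vf M) -[EG (inTs eta)]/(0 : sect G).
  by rewrite Rform0r !conn0l slie0r !addr0 subr0.
Qed.

Lemma dorfman_TsG r eta : dorfman D (inTs eta) (frameG r) = 0.
Proof.
have := dorfman_sym D (inTs eta) (frameG r).
rewrite dorfman_GTs addr0 => ->.
have -> : Epair (inTs eta) (frameG r) = 0.
  rewrite /Epair ET_frameG.
  rewrite -[ET (inTs eta)]/(0 : vf M) -[EG (inTs eta)]/(0 : sect G).
  by rewrite !oneform0 sform0l !addr0 scaler0.
have -> : dfun (0 : Cinf M) = 0 by apply: oneform_eq => Z; rewrite /= vapp0r.
by rewrite -[inTs 0]/(0 : Esec G) mul0rn.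
Qed.

Lemma dorfman_TsTs xi eta : dorfman D (inTs xi) (inTs eta) = 0.
Proof.
apply: Esec_eq => [|Z|].
- by rewrite ET_dorfman vbr0r.
- rewrite ETs_dorfman.
  change (Hform D 0 0 Z + (0 - eta (vbr 0 Z)) - (0 - xi (vbr 0 Z)) + Z (xi 0)
    - sform (Rform D 0 Z) (0 : sect G) *+ 2 + sform (Rform D 0 Z) 0 *+ 2
    + sform (conn D Z 0) 0 *+ 2 = 0).
  rewrite Hform0m vbr0l !oneform0 vapp0r !sform0r.
  by rewrite !mul0rn !subr0 !addr0.
- rewrite EG_dorfman -[ET (inTs _)]/(0 : vf M) -[EG (inTs _)]/(0 : sect G).
  by rewrite Rform0r !conn0l slie0r !addr0 subr0.
Qed.

Lemma mixed_formE X r Z : mixed_form X r Z = - (sform (twisted_R X Z) r *+ 2).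
Proof.
change (ETs (dorfman D (frameT X) (frameG r)) Z - ETs (frameG (tconn X r)) Z =
  - (sform (twisted_R X Z) r *+ 2)).
rewrite ETs_dorfman !ETs_frameG ET_frameT ET_frameG EG_frameG EG_frameT.
rewrite Hform0m vbr0l !oneform0 vapp0r Rform0l sform0l.
rewrite -[ETs (frameT X)]/(theta X) !vapp0l.
rewrite vappN vappMn (conn_form D) /twisted_R /dD1.
rewrite !(sformDl, sformDr, sformNl).
rewrite -sform_ad (slie_skew _ (sigma Z)) sformNl.
by ring.
Qed.

Lemma vertical_formE r s Z : vertical_form r s Z = sform (tconn Z r) s *+ 2.
Proof.
change (ETs (dorfman D (frameG r) (frameG s)) Z - ETs (frameG (slie r s)) Z =
  sform (tconn Z r) s *+ 2).
rewrite ETs_dorfman !ET_frameG !EG_frameG.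
rewrite Hform0m vbr0l !oneform0 !ETs_frameG !vapp0l !vapp0r Rform0l !sform0l.
rewrite sformDl sform_ad.
by ring.
Qed.

(** As theta = B_J - g with g(X, Y) = <sigma X, sigma Y>, the terms in B_J add up
    to its exterior derivative. In the terms in g, metricity of nabla
    differentiates the products and R' = 0 replaces sigma [X, Y]; all covariant
    derivatives of sigma cancel against those of the Dorfman bracket, leaving
    the curvature terms and one copy of <[sigma X, sigma Y], sigma Z>, which by
    ad-invariance is a third of the cyclic sum. *)
Lemma twisted_HE X Y Z : (forall X' Y', twisted_R X' Y' = 0) ->
  twisted_H X Y Z =
  d2 (formBJ Binv (compJ JJ)) X Y Z + Hform D X Y Z +
    wedge21 (fun X Y => Rform D X Y - rscale (3^-1) (sigma2 X Y)) sigma X Y Z.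
Proof.
move=> R0.
have BJE X' Y' : formBJ Binv (compJ JJ) X' Y' =
    theta X' Y' + sform (sigma X') (sigma Y').
  have e1 : Binv (compJ JJ X') Y' = theta Y' X' by rewrite Binv_skew thetaE.
  have e2 : Binv X' (compJ JJ Y') = - theta X' Y' by rewrite thetaE opprK.
  rewrite /formBJ e1 e2 theta_swap.
  have -> : - theta X' Y' - sform (sigma X') (sigma Y') *+ 2 - theta X' Y' =
    (- (theta X' Y' + sform (sigma X') (sigma Y'))) *+ 2 by ring.
  by rewrite -scalerMnr Cinf_half opprK.
(* This is R' = 0, solved for the term with the bracket. *)
have sE X' Y' : sigma (vbr X' Y') = conn D X' (sigma Y') - conn D Y' (sigma X')
    + sigma2 X' Y' + Rform D X' Y'.
  have := R0 X' Y'; rewrite /twisted_R /dD1 => /eqP.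
  by rewrite -addrA addrAC subr_eq0 addrA => /eqP <-.
change (ETs (dorfman D (frameT X) (frameT Y)) Z - theta (vbr X Y) Z
  - ETs (frameG (twisted_R X Y)) Z =
  d2 (formBJ Binv (compJ JJ)) X Y Z + Hform D X Y Z +
    wedge21 (fun X Y => Rform D X Y - rscale (3^-1) (sigma2 X Y)) sigma X Y Z).
rewrite ETs_dorfman ETs_frameG R0 sform0r !ET_frameT !EG_frameT.
rewrite -![ETs (frameT _)]/(theta _) /d2 /wedge21 /cyc !BJE.
rewrite (theta_swap X Z) (theta_swap X (vbr Y Z)) (theta_swap Y (vbr Z X)).
rewrite (vbr_skew Z X) oneformN !sE.
set x := compnu JJ (Binv X); set y := compnu JJ (Binv Y).
set z := compnu JJ (Binv Z).
rewrite !(vappD, vappN, vappMn) !(conn_form D).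
rewrite !(sformDl, sformDr, sformNl, sformNr).
rewrite (Rform_skew D X Z) (slie_skew x z) !sformZl !(sformNl, sformNr).
rewrite !(sformC (conn D _ _)) !(sformC (slie _ _)) !(sformC (Rform D _ _)).
(* By ad-invariance the three cyclic products are one scalar. *)
have tx : sform x (slie y z) = sform z (slie x y) by rewrite -sform_ad sformC.
have ty : sform y (slie x z) = - sform z (slie x y).
  by rewrite (slie_skew z x) sformNr -sform_ad sformC tx.
rewrite ty tx !opprK; set h : Cinf M := 3^-1 *: (1 : Cinf M).
set t := sform z (slie x y).
have h3 : h *+ 3 = 1.
  by rewrite /h -[LHS]scaler_nat scalerA divff ?pnatr_eq0// scale1r.
(* Writing t as 3 q absorbs the factor 1/3 of the condition. *)
set q := h * t.
have -> : t = q *+ 3 by rewrite -mulrnAl h3 mul1r.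
by ring.
Qed.

(** * The Nijenhuis tensor in the adapted frame *)

Local Notation NJ := (nijenhuis JJ (dorfman D)).

Definition d_Binv_form X Y : oneform M :=
  lieD X (Binv Y) + (dfun (Binv X Y) - lieD Y (Binv X)) - Binv (vbr X Y).

(** Cartan's formula for the differential of the 2-form B^-1. *)
Lemma d_Binv_formE X Y Z : d_Binv_form X Y Z = d2 (fun X Y => Binv X Y) X Y Z.
Proof.
change (X (Binv Y Z) - Binv Y (vbr X Z) + (Z (Binv X Y)
  - (Y (Binv X Z) - Binv X (vbr Y Z))) - Binv (vbr X Y) Z =
  d2 (fun X Y => Binv X Y) X Y Z).
rewrite /d2 /cyc (vbr_skew Z X) (Binv_skew X Z) oneformN.
rewrite (Binv_skew X (vbr Y Z)) (Binv_skew Y (vbr Z X)) !vappN.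
by ring.
Qed.

Lemma nijenhuis_TsTs X Y : NJ (inTs (Binv X)) (inTs (Binv Y)) =
  - (inTs (d_Binv_form X Y) + frameT (B (twisted_H X Y))
     + frameG (At (twisted_R X Y))).
Proof.
rewrite /nijenhuis dorfman_TsTs sub0r dorfman_TT linearN.
rewrite (linearD JJ (_ + _)) (linearD JJ (frameT _)).
rewrite -[JJ (inTs (Binv X))]/(frameT X) -[JJ (inTs (Binv Y))]/(frameT Y).
rewrite JJ_frameT JJ_frameG JJ_inTs dorfman_TTs dorfman_TsT.
rewrite /d_Binv_form !inTsD !inTsN.
rewrite -opprD; congr (- _); rewrite [LHS]addrC [RHS]addrAC.
rewrite -!addrA [RHS]addrCA; congr (_ + _); exact: addrCA.
Qed.

Lemma nijenhuis_TsG X r : NJ (inTs (Binv X)) (frameG r) =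
  - (inTs (mixed_form X r) + frameT (B (mixed_form X (At r)))
     + frameG (At (tconn X (At r)) + tconn X r)).
Proof.
rewrite /nijenhuis dorfman_TsG sub0r JJ_frameG dorfman_TsG add0r.
rewrite -[JJ (inTs (Binv X))]/(frameT X) !dorfman_TG linearN.
rewrite (linearD JJ (frameG _)) JJ_frameG JJ_inTs -opprD frameGD; congr (- _).
by rewrite [LHS]addrACA [LHS]addrC [X in X + _ = _]addrC.
Qed.

Lemma nijenhuis_GTs X r : NJ (frameG r) (inTs (Binv X)) =
  - NJ (inTs (Binv X)) (frameG r).
Proof.
rewrite /nijenhuis dorfman_TsG dorfman_GTs JJ_frameG dorfman_TsG dorfman_GTs.
rewrite -[JJ (inTs (Binv X))]/(frameT X) !dorfman_GT !sub0r opprK addr0 add0r.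
by rewrite opprD (linearN JJ (dorfman _ _ _)) !opprK.
Qed.

Lemma nijenhuis_GG r s : NJ (frameG r) (frameG s) =
  inTs (- (vertical_form r (At s) + vertical_form (At r) s))
  + frameT (B (vertical_form r s - vertical_form (At r) (At s)))
  + frameG (nijenhuis At (@slie _ _ _ _ G) r s).
Proof.
rewrite /nijenhuis !JJ_frameG !dorfman_GG -JJ_inTs.
have sumGTs p q xi eta : frameG p + inTs xi + (frameG q + inTs eta) =
    frameG (p + q) + inTs (xi + eta).
  by rewrite [LHS]addrACA -frameGD -inTsD.
have oppGTs p xi : - (frameG p + inTs xi) = frameG (- p) + inTs (- xi).
  by rewrite opprD -frameGN -inTsN.
rewrite oppGTs 2!sumGTs oppGTs (linearD JJ (frameG _)) JJ_frameG.
by rewrite [LHS]addrACA -frameGD [LHS]addrC [X in X + _ = _]addrC.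
Qed.

(** At is orthogonal, being skew with square -1. *)
Lemma twisted_conn_parallel_sform :
  (forall X r, tconn X (At r) = At (tconn X r)) ->
  forall X r s, sform (tconn X (At r)) (At s) = sform (tconn X r) s.
Proof.
by move=> tA X r s; rewrite tA tildeA_skew tildeA2 sformNr opprK.
Qed.

(** The frame turns each value of the Nijenhuis tensor into three independent
    components. Conversely the tensor vanishes as soon as it does on the
    one-forms and on the sections frameG r, since the lifts frameT X are
    JJ-images of one-forms. *)
Lemma integrableP :
  integrable D JJ <-> [/\ forall X Y Z, d2 (fun X Y => Binv X Y) X Y Z = 0,
    forall r s, nijenhuis At (@slie _ _ _ _ G) r s = 0,
    forall X r, tconn X (At r) = At (tconn X r),
    forall X Y, twisted_R X Y = 0 &
    forall X Y, twisted_H X Y = 0].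
Proof.
have dDl v : {morph (dorfman D)^~ v : u w / u + w}.
  by move=> u w; exact: dorfmanDl.
have dDr u : {morph dorfman D u : v w / v + w}.
  by move=> v w; exact: dorfmanDr.
have B0 : B 0 = 0 := morphD0 (linear_morphD (compB_linear)).
have JJ0 : JJ 0 = 0 by exact: linear0.
have At0 : At 0 = 0 := morphD0 tildeAD.
rewrite /integrable eigen_i_closedP//; first last.
- by move=> u; exact: morphDN.
- by move=> v; exact: morphDN.
- exact: linearN.
split=> [N0|[dw NA tA R0 H0] u v].
  have TT X Y := N0 (inTs (Binv X)) (inTs (Binv Y)).
  have TG X r := N0 (inTs (Binv X)) (frameG r).
  split.
  - move=> X Y Z; have /eqP := TT X Y; rewrite nijenhuis_TsTs oppr_eq0 => /eqP.
    by move=> /frame_eq0[w0 _ _]; rewrite -d_Binv_formE w0.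
  - move=> r s; have := N0 (frameG r) (frameG s); rewrite nijenhuis_GG.
    by move=> /frame_eq0[_ _].
  - move=> X r; have /eqP := TG X r; rewrite nijenhuis_TsG oppr_eq0 => /eqP.
    move=> /frame_eq0[_ _ /eqP]; rewrite addr_eq0 => /eqP e.
    rewrite -[LHS]opprK -(tildeA2 (tconn X (At r))) e.
    by rewrite (morphDN tildeAD) opprK.
  - move=> X Y; have /eqP := TT X Y; rewrite nijenhuis_TsTs oppr_eq0 => /eqP.
    move=> /frame_eq0[_ _ e]; apply: oppr_inj.
    by rewrite -tildeA2 e At0 oppr0.
  - move=> X Y; have /eqP := TT X Y; rewrite nijenhuis_TsTs oppr_eq0 => /eqP.
    by move=> /frame_eq0[_ e _]; rewrite -(BK (twisted_H X Y)) e -B0 BK.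
have sA := twisted_conn_parallel_sform tA.
have m0 X r : mixed_form X r = 0.
  by apply: oneform_eq => Z; rewrite mixed_formE R0 sform0l mul0rn oppr0.
have TT X Y : NJ (inTs (Binv X)) (inTs (Binv Y)) = 0.
  rewrite nijenhuis_TsTs; apply/eqP; rewrite oppr_eq0; apply/eqP/frame_eq0.
  rewrite R0 H0 B0 At0; split=> //; apply: oneform_eq => Z.
  by rewrite d_Binv_formE dw.
have TG X r : NJ (inTs (Binv X)) (frameG r) = 0.
  rewrite nijenhuis_TsG; apply/eqP; rewrite oppr_eq0; apply/eqP/frame_eq0.
  by rewrite !m0 B0 tA tildeA2 addNr.
have GG r s : NJ (frameG r) (frameG s) = 0.
  rewrite nijenhuis_GG; apply/frame_eq0; rewrite NA; split=> //.
    apply: oneform_eq => Z.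
    change (- (vertical_form r (At s) Z + vertical_form (At r) s Z) = 0).
    rewrite !vertical_formE -(sA Z r (At s)) tildeA2 sformNr mulNrn addNr.
    exact: oppr0.
  have -> : vertical_form r s - vertical_form (At r) (At s) = 0.
    apply: oneform_eq => Z.
    change (vertical_form r s Z - vertical_form (At r) (At s) Z = 0).
    by rewrite !vertical_formE sA subrr.
  exact: B0.
have GT X r : NJ (frameG r) (inTs (Binv X)) = 0.
  by rewrite nijenhuis_GTs TG oppr0.
have Nl w : (forall X, NJ (inTs (Binv X)) w = 0) ->
    (forall r, NJ (frameG r) w = 0) -> forall w', NJ w' w = 0.
  move=> NT NG w'; have [xi [X [r ->]]] := frame_decomp w'.
  rewrite -(BK xi) (nijenhuisDl JJ dDl w (_ + _)).
  rewrite (nijenhuisDl JJ dDl w (inTs _)).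
  rewrite (nijenhuisJl JJ2 dDl (inTs (Binv X))).
  rewrite !NT NG; change (0 - JJ 0 + 0 = 0 :> Esec G).
  by rewrite JJ0 oppr0 !addr0.
have Nr w : (forall X, NJ w (inTs (Binv X)) = 0) ->
    (forall r, NJ w (frameG r) = 0) -> forall w', NJ w w' = 0.
  move=> NT NG w'; have [xi [X [r ->]]] := frame_decomp w'.
  rewrite -(BK xi) (nijenhuisDr JJ dDr w (_ + _)).
  rewrite (nijenhuisDr JJ dDr w (inTs _)).
  rewrite (nijenhuisJr JJ2 dDr w (inTs (Binv X))).
  rewrite !NT NG; change (0 - JJ 0 + 0 = 0 :> Esec G).
  by rewrite JJ0 oppr0 !addr0.
by apply: Nl => [X|r]; apply: Nr.
Qed.

End NormalForm.

(** * Smooth cutoff functions *)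

Import Order.TTheory Num.Theory numFieldNormedType.Exports.
Local Open Scope classical_set_scope.

Section Flat.
Context {R : realType}.
Implicit Types (m : nat) (x : R).

Lemma diff_comp_real (V : normedModType R) (g : V -> R) (f : R -> R) a v df :
  differentiable g a -> is_derive (g a) 1 f df ->
  differentiable (f \o g) a /\ 'D_v (f \o g) a = df * 'D_v g a.
Proof.
move=> dg [dfg fE]; have dF : differentiable f (g a) by exact/derivable1_diffP.
have dfgx := differentiable_comp dg dF; split=> //.
rewrite !deriveE// diff_comp// diff1E//= derive1E fE.
exact: mulrC.
Qed.

(** The derivatives of exp(-1/x), extended by 0, are combinations of these
    functions; having the whole family at hand makes it stable under
    differentiation. *)
Definition flat m x : R := if 0 < x then x^-1 ^+ m * expR (- x^-1) else 0.

(** The term of degree m + 1 of the exponential series of 1/x dominates. *)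
Lemma flat_le m x : `|flat m x| <= (m.+1)`!%:R * `|x|.
Proof.
rewrite /flat; case: ifPn => x0; last by rewrite normr0 mulr_ge0.
have u0 : 0 < x^-1 by rewrite invr_gt0.
rewrite !gtr0_norm ?mulr_gt0 ?exprn_gt0 ?expR_gt0//.
rewrite expRN ler_pdivrMr ?expR_gt0//.
have -> : x^-1 ^+ m = x^-1 ^+ m.+1 * x.
  by rewrite exprSr -mulrA mulVf ?gt_eqF// mulr1.
rewrite mulrAC ler_pM2r// -ler_pdivrMl ?ltr0n ?fact_gt0// mulrC.
by apply: le_trans (expR_ge1Dxn m (ltW u0)); rewrite lerDr.
Qed.

Lemma is_derive_flat m x :
  is_derive x 1 (flat m) (flat m.+2 x - m%:R * flat m.+1 x).
Proof.
have [x0|x0|->] := ltgtP x 0.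
- rewrite /flat !(lt_gtF x0) mulr0 subr0.
  apply: (@near_eq_is_derive _ _ _ (cst 0)).
  near=> y; rewrite ifF//; apply/negbTE; rewrite -leNgt; apply: ltW.
  by near: y; exact: lt_nbhsl.
- have dV : is_derive x 1 (fun y : R => y^-1) (- x^-2).
    apply: DeriveDef.
      by apply: derivableV; [rewrite gt_eqF|exact: derivable_id].
    by rewrite deriveV ?gt_eqF// derive_id /GRing.scale/= mulr1.
  have dVX := is_deriveX m dV.
  have dVN := is_deriveN dV.
  have dV1 : derivable (- (fun y : R => y^-1)) x 1 by case: dVN.
  have dfV := (derivable1_diffP _ _).1 dV1.
  have [dE DE] := @diff_comp_real R _ _ x 1 _ dfV (is_derive_expR _).
  have dE' := DeriveDef ((derivable1_diffP _ _).2 dE) DE.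
  apply: is_derive_eq.
    apply: near_eq_is_derive (is_deriveM dVX dE').
    near=> y; have y0 : 0 < y by near: y; exact: lt_nbhsr.
    by rewrite /flat y0 !fctE.
  have -> : 'D_1 (- (fun y : R => y^-1)) x = - - x ^- 2 by case: dVN.
  rewrite /flat x0 opprK !fctE /GRing.scale/= -!exprVn !exprS.
  move: (expR _) => e; move: x^-1 => u.
  by case: (m) => [|m'] /=; rewrite ?exprS; ring.
- have flat0 p : flat p 0 = 0 by rewrite /flat ltxx.
  rewrite !flat0 mulr0 subr0.
  (* The difference quotient of flat m at 0 is flat (m + 1). *)
  have cv0 : h^-1 *: ((flat m \o shift 0) (h *: 1) - flat m 0) @[h --> 0^']
      --> (0 : R).
    apply/cvgr0Pnorm_lt => e e0; near=> h.
    rewrite flat0 subr0 /= addr0 /GRing.scale/= mulr1.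
    have -> : h^-1 * flat m h = flat m.+1 h.
      by rewrite /flat; case: ifP; rewrite ?mulr0// exprS mulrA.
    apply: (le_lt_trans (flat_le _ _)).
    rewrite -ltr_pdivlMl ?ltr0n ?fact_gt0//; near: h; apply: dnbhs0_lt.
    by rewrite mulr_gt0// invr_gt0 ltr0n fact_gt0.
  by apply: DeriveDef; [apply/cvg_ex; exists 0|exact: cvg_lim cv0].
Unshelve. all: by end_near. Qed.

Section Smooth.
Variable n : nat.
Implicit Types (W : set 'rV[R]_n) (g : 'rV[R]_n -> R) (c : 'rV[R]_n) (e : R).

(** The induction is on the order of differentiability and for all m at once: by
    the chain rule a derivative of flat m o g is a product of a combination of
    flat (m + 2) o g and flat (m + 1) o g with a derivative of g. *)
Lemma diff_upto_flat (j : nat) W g : open W -> (forall i, diff_upto i W g) ->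
  forall m, diff_upto j W (flat m \o g).
Proof.
move=> oW gS; elim: j => // j IH m; have [dg _] := gS 1.
split=> [x Wx|v].
  by have [] := @diff_comp_real _ _ _ x 0 _ (dg x Wx) (is_derive_flat m (g x)).
apply: (@diff_upto_ext _ _ _ _
  (((flat m.+2 \o g) + (fun=> - m%:R) * (flat m.+1 \o g)) * 'D_v g))
  => // [x Wx|].
  have [_ ->] := @diff_comp_real _ _ _ x v _ (dg x Wx) (is_derive_flat m (g x)).
  by rewrite !fctE mulNr.
apply: diff_uptoM => //; last by have [_ Dg] := gS j.+1; exact: Dg.
apply: diff_uptoD => //; apply: diff_uptoM => //; exact: diff_upto_cst.
Qed.

Lemma diff_upto_union j W W' g :
  diff_upto j W g -> diff_upto j W' g -> diff_upto j (W `|` W') g.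
Proof.
elim: j g => //= j IH g [dg Dg] [dg' Dg']; split=> [x [/dg|/dg']//|v].
by apply: IH; [exact: Dg|exact: Dg'].
Qed.

(** The sum of squares is smooth, unlike the sup norm of row vectors; the
    resulting support is the Euclidean ball, which lies in the cube of the same
    radius. *)
Definition bump c e (x : 'rV[R]_n) : R :=
  flat 0 (1 - \sum_j ((x ord0 j - c ord0 j) / e) ^+ 2) / flat 0 1.

Lemma bump_center c e : bump c e c = 1.
Proof.
rewrite /bump big1 ?subr0 => [|j _]; last by rewrite subrr mul0r expr0n.
by rewrite divff// /flat ltr01 expr0 mul1r gt_eqF// expR_gt0.
Qed.

Lemma bump_out c e (x : 'rV[R]_n) : 0 < e -> e < `|x - c| -> bump c e x = 0.
Proof.
move=> e0 ex; rewrite /bump /flat ifF ?mul0r//; apply/negbTE.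
have : `|x - c| != 0 by rewrite gt_eqF// (lt_trans e0).
move=> /mx_norm_neq0[[i j]]; rewrite -[mx_norm _]/(`|x - c|) => nE.
rewrite -leNgt subr_le0 (bigD1 j)//= ler_wpDr ?sumr_ge0// => [k _|].
  exact: sqr_ge0.
rewrite -[leRHS]ger0_norm ?sqr_ge0// normrX expr_ge1//.
rewrite normrM normfV (gtr0_norm e0) ler_pdivlMr// mul1r ltW//.
by move: ex; rewrite nE /= !mxE ord1.
Qed.

Lemma bump_smooth c e W (h : 'rV[R]_n -> 'rV[R]_n) : open W ->
  (forall j, smooth_open W (fun y => h y ord0 j)) ->
  smooth_open W (bump c e \o h).
Proof.
move=> oW hS i.
have -> : bump c e \o h = (flat 0 \o (fun y => 1 + (- 1) *
    \sum_j ((h y ord0 j - c ord0 j) / e) ^+ 2)) * (fun=> (flat 0 1)^-1).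
  by apply/funext => y; rewrite !fctE /= mulN1r.
apply: diff_uptoM => //; last exact: diff_upto_cst.
apply: diff_upto_flat => // {}i.
apply: (diff_uptoD oW); first exact: diff_upto_cst.
apply: (diff_uptoM oW); first exact: diff_upto_cst.
have -> : (fun y => \sum_j ((h y ord0 j - c ord0 j) / e) ^+ 2) =
    \sum_j (fun y => ((h y ord0 j - c ord0 j) / e) ^+ 2).
  by apply/funext => y; rewrite fct_sumE.
elim/big_ind : _ => [|f g fS gS|j _]; first exact: diff_upto_cst.
  exact: diff_uptoD.
have S1 : diff_upto i W (fun y => (h y ord0 j - c ord0 j) / e).
  apply: (diff_uptoM oW); last exact: diff_upto_cst.
  by apply: (diff_uptoD oW); [exact: hS|exact: diff_upto_cst].
exact: (diff_uptoM oW S1 S1).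
Qed.

End Smooth.
End Flat.

Section Cutoff.
Context {R : realType} {n : nat} (M : manifold R n).
Implicit Types (U V : set M) (f g : M -> R).

Lemma smooth_on_union U V f :
  smooth_on U f -> smooth_on V f -> smooth_on (U `|` V) f.
Proof.
move=> sU sV a i; rewrite setIUr image_setU.
by apply: diff_upto_union; [exact: sU|exact: sV].
Qed.

(** In a chart, take a bump function supported in a cube whose preimage in the
    manifold lies in U. That preimage is compact, hence closed because the
    manifold is Hausdorff, so the extension by zero is smooth; V is the
    complement of this preimage. *)
Lemma exists_cutoff (p : M) U : open U -> U p ->
  exists (chi : Cinf M) (V : set M), [/\ chi p = 1, open V,
    U `|` V = setT & forall q, V q -> chi q = 0].
Proof.
move=> oU Up; have [a ap] := cdom_cover p.
set x0 := cmap a p.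
have : nbhs x0 (cmap a @` (cdom a `&` U)).
  apply: open_nbhs_nbhs; split; first exact: chart_image_open.
  by exists p.
move=> /nbhs_closedballP[e eW]; set K := closed_ball x0 e%:num in eW.
have e0 : 0 < e%:num by [].
have KE y : K y = (`|x0 - y| <= e%:num) by rewrite /K closed_ballE.
have K_compact : compact K.
  apply: bounded_closed_compact; last exact: closed_ball_closed.
  exists (`|x0| + e%:num); split=> [|r xr y]; first exact: num_real.
  rewrite KE => Ky; apply: le_trans (ltW xr).
  rewrite -[y](subKr x0); apply: le_trans (ler_normB _ _) _.
  by rewrite lerD2l.
have C_closed : closed (cinv a @` K).
  apply: compact_closed; first exact: points_hausdorff.
  apply: continuous_compact => //; apply: continuous_in_subspaceT => x.
  rewrite inE => Kx; apply: cinv_continuous.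
  by have [q [aq _] <-] := eW _ Kx; exists q.
have CU : cinv a @` K `<=` cdom a `&` U.
  by move=> _ [x Kx <-]; have [q [aq Uq] <-] := eW _ Kx; rewrite cmapK.
pose f (q : M) : R := if `[< cdom a q >] then bump x0 e%:num (cmap a q) else 0.
have fV q : (~` (cinv a @` K)) q -> f q = 0.
  move=> nKq; rewrite /f; case: ifPn => // /asboolP aq; apply: bump_out => //.
  rewrite ltNge distrC; apply/negP; rewrite -KE => Kq; apply: nKq.
  by exists (cmap a q) => //; exact: cmapK.
have V_open : open (~` (cinv a @` K)) by exact: closed_openC.
have f_smooth : smooth_on setT f.
  have -> : setT = cdom a `|` ~` (cinv a @` K) :> set M.
    apply/esym/seteqP; split=> // q _.
    by have [/CU[aq _]|nq] := pselect ((cinv a @` K) q); [left|right].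
  apply: smooth_on_union.
    move=> b; have oW := chart_image_open (a := b) (cdom_open a).
    move=> i; apply: (diff_upto_ext
      (f := bump x0 e%:num \o (fun y => cmap a (cinv b y)))) => //.
      move=> _ [q [bq aq] <-]; rewrite /= /f cmapK// ifT//; exact/asboolP.
    by apply: bump_smooth => // j; exact: transition_smooth.
  apply: (smooth_on_ext (f := fun=> 0)) => // [q Vq|]; first by rewrite fV.
  exact: smooth_on_cst.
exists (MkCinf (introT (asboolP _) f_smooth)), (~` (cinv a @` K)).
split=> //=.
- by rewrite /f ifT ?bump_center//; exact/asboolP.
- apply/seteqP; split=> // q _.
  by have [/CU[_ Uq]|nq] := pselect ((cinv a @` K) q); [left|right].
Qed.

End Cutoff.

(** * Sections and tensoriality *)

Section Tensoriality.
Context {R : realType} {n : nat} {M : manifold R n} {k : nat} (V : vbundle M k).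
Implicit Types (p q : M) (s t : sect V) (f g : Cinf M).

Lemma sect_sumE (I : finType) (F : I -> sect V) q :
  (\sum_j F j) q = \sum_j F j q.
Proof. exact: (big_morph (fun s : sect V => s q)). Qed.

(** A local frame, and the coordinates in it of a global section, become global
    after multiplication with a cutoff function. *)
Lemma exists_cutoff_frame p : exists (i : triv V) (chi : Cinf M)
    (e : 'I_k -> sect V) (c : 'I_k -> sect V -> Cinf M),
  [/\ bdom i p, chi p = 1, forall j q, e j q = chi q *: tnth (bframe i q) j,
    forall j s q, c j s q = chi q * coord (bframe i q) j (s q) &
    forall q, bdom i q \/ chi q = 0].
Proof.
have [i ip] := bdom_cover V p.
have [chi [W [chip oW UW chi0]]] := exists_cutoff (bdom_open i) ip.
have ext U (f : M -> R) : open U -> smooth_on (bdom i `&` U) f ->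
    smooth_on U (fun q => chi q * f q).
  move=> oU sf.
  have -> : U = (bdom i `&` U) `|` (W `&` U) by rewrite -setIUl UW setTI.
  apply: smooth_on_union.
    apply: smooth_onM => //; last exact/smooth_onT/CinfP.
    by apply: openI => //; exact: bdom_open.
  apply: (smooth_on_ext (f := fun=> 0)); last exact: smooth_on_cst.
    exact: openI.
  by move=> q [Wq _]; rewrite chi0// mul0r.
have eS j : smooth_sect (fun q => chi q *: tnth (bframe (v := V) i q) j).
  move=> i' j'.
  rewrite (_ : (fun q => _) =
    (fun q => chi q * coord (bframe i' q) j' (tnth (bframe i q) j))).
    by apply: ext; [exact: bdom_open|rewrite setIC; exact: bframe_smooth].
  by apply/funext => q; rewrite linearZ.
have cS j s :
    (fun q => chi q * coord (bframe i q) j (s q)) \in smooth_pred (M := M).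
  by apply/asboolP/ext; [exact: openT|rewrite setIT; exact: sectP].
exists i, chi, (fun j => MkSect (eS j)), (fun j s => MkCinf (cS j s)).
split=> //.
move=> q; have : setT q by [].
by rewrite -UW => -[|/chi0]; [left|right].
Qed.

Lemma exists_section p (a : fib V p) : exists s, s p = a.
Proof.
have [i [chi [e [_ [ip chip eE _ _]]]]] := exists_cutoff_frame p.
pose x j : Cinf M := coord (bframe i p) j a *: (1 : Cinf M).
exists (\sum_j x j *: e j); rewrite sect_sumE.
have /(coord_span (v := a)) : a \in <<bframe i p>>%VS.
  by rewrite (span_basis (bframe_basis ip)) memvf.
move=> aE; rewrite [RHS]aE; apply: eq_bigr => j _.
rewrite -[LHS]/((coord (bframe i p) j a * 1) *: e j p) eE chip scale1r mulr1.
by rewrite (tnth_nth 0).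
Qed.

(** The section u = s - t vanishes at p, and chi^2 u = sum_j (chi u_j) (chi e_j)
    where the functions chi u_j vanish at p; apply A and evaluate at p. *)
Lemma tensorial (A : sect V -> sect V) p s t :
  (forall f s' t', A (f *: s' + t') = f *: A s' + A t') ->
  s p = t p -> A s p = A t p.
Proof.
move=> A_linear st.
have AD := linear_morphD A_linear; have A0 := morphD0 AD.
have AZ f s' : A (f *: s') = f *: A s'.
  by rewrite -[f *: s']addr0 A_linear A0 addr0.
have -> : s = t + (s - t) by rewrite addrC subrK.
rewrite AD; set u := s - t.
have up : u p = 0 by rewrite -[u p]/(s p - t p) st subrr.
suff Au : A u p = 0 by rewrite -[(A t + A u) p]/(A t p + A u p) Au addr0.
have [i [chi [e [c [ip chip eE cE supp]]]]] := exists_cutoff_frame p.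
have uE : (chi * chi) *: u = \sum_j c j u *: e j.
  apply: sect_eq => q; rewrite sect_sumE -[LHS]/((chi q * chi q) *: u q).
  have cej j : (c j u *: e j) q =
      (chi q * chi q) *: (coord (bframe i q) j (u q) *: tnth (bframe i q) j).
    by rewrite -[LHS]/(c j u q *: e j q) eE cE !scalerA mulrAC.
  under eq_bigr do rewrite cej.
  rewrite -scaler_sumr; have [iq|->] := supp q; last by rewrite mul0r !scale0r.
  congr (_ *: _).
  have /(coord_span (v := u q)) {1}-> : u q \in <<bframe i q>>%VS.
    by rewrite (span_basis (bframe_basis iq)) memvf.
  by apply: eq_bigr => j _; rewrite (tnth_nth 0).
have : A ((chi * chi) *: u) p = 0.
  rewrite uE (big_morph A AD A0) sect_sumE big1// => j _.
  by rewrite AZ -[LHS]/(c j u p *: A (e j) p) cE up linear0 mulr0 scale0r.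
rewrite AZ -[X in X = _]/((chi p * chi p) *: A u p) chip mulr1 scale1r.
exact.
Qed.

End Tensoriality.

(** * Integrability on the fibres *)

Section Fibrewise.
Context {R : realType} {n : nat} {M : manifold R n} {k : nat}.
Context {G : quad_lie_bundle M k} (A : sect G -> sect G).
Hypothesis A_linear : forall f s t, A (f *: s + t) = f *: A s + A t.

(** The value of an induced endomorphism on a fibre may be computed with any
    section through the vector, not only with the chosen one. *)
Lemma endo_atE p (s : sect G) : endo_at A p (s p) = A s p.
Proof.
apply: tensorial => //.
by apply: (xgetPex 0 (P := [set t : sect G | t p = s p]%classic)); exists s.
Qed.

Lemma integrable_complexP : (forall r, A (A r) = - r) ->
  integrable_complex A <-> forall r s, nijenhuis A (@slie _ _ _ _ G) r s = 0.
Proof.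
move=> A2.
have AN := morphDN (linear_morphD A_linear).
have fibre p : eigen_i_closed (endo_at A p) (@lie _ _ _ _ G p) <->
    forall a b, nijenhuis (endo_at A p) (@lie _ _ _ _ G p) a b = 0.
  have [L1 L2 _ _] := lie_axioms G p.
  apply: eigen_i_closedP => [a|a|b|a].
  - by have [s <-] := exists_section a; rewrite -[- s p]/((- s) p) !endo_atE AN.
  - by have [s <-] := exists_section a; rewrite !endo_atE A2.
  - by apply: morphDN => x y; have := L1 1 x y b; rewrite !scale1r.
  - by apply: morphDN => x y; have := L2 1 a x y; rewrite !scale1r.
have nijE p (r s : sect G) :
    nijenhuis (endo_at A p) (@lie _ _ _ _ G p) (r p) (s p) =
    nijenhuis A (@slie _ _ _ _ G) r s p.
  rewrite /nijenhuis !endo_atE.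
  change (lie (r p) (s p) - lie (A r p) (A s p)) with
    ((slie r s - slie (A r) (A s)) p).
  by rewrite endo_atE.
split=> [[_ cl] r s|N0].
  apply: sect_eq => p; rewrite -nijE.
  by have /fibre -> := cl p.
split=> // p; apply/fibre => a b.
have [r <-] := exists_section a; have [s <-] := exists_section b.
by rewrite nijE N0.
Qed.

End Fibrewise.

Theorem proposition10 (R : realType) (n : nat) (M : manifold R n)
  (M_connected : connected [set: M]%classic)
  (k : nat) (G : quad_lie_bundle M k)
  (G_neutral : forall p : M, neutral_form (@qform R n M k G p))
  (D : courant_data G)
  (JJ : {linear Esec G -> Esec G}) (JJ_gacs : gen_almost_complex JJ)
  (Binv : vf M -> oneform M)
  (BK : cancel (compB JJ) Binv) (BinvK : cancel Binv (compB JJ)) :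
  let J := compJ JJ in
  let nu := compnu JJ in
  let At := tildeA JJ Binv in
  let sigma := fun X : vf M => nu (Binv X) in
  let sigma2 := fun X Y : vf M => slie (sigma X) (sigma Y) in
  integrable D JJ <->
  [/\ symplectic (fun X Y : vf M => Binv X Y),
      integrable_complex At,
      (forall (X : vf M) (r : sect G),
        twisted_conn D sigma X (At r) - At (twisted_conn D sigma X r) = 0),
      (forall X Y : vf M,
        dD1 (conn D) sigma X Y + sigma2 X Y + Rform D X Y = 0) &
      (forall X Y Z : vf M,
        d2 (formBJ Binv J) X Y Z + Hform D X Y Z +
        wedge21 (fun X Y : vf M => Rform D X Y - rscale (3^-1) (sigma2 X Y))
          sigma X Y Z = 0)].
Proof.
move=> J nu At sigma sigma2.
have At_linear : forall f r s, At (f *: r + s) = f *: At r + At s :=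
  tildeA_linear BK BinvK.
have At2 : forall r, At (At r) = - r := tildeA2 JJ_gacs BinvK.
have intJ := integrableP D JJ_gacs BK BinvK.
have intA := integrable_complexP At_linear At2.
split=> [/intJ[dw NA tA R0 H0]|[[_ _ dw] /intA NA tA R0 H0]].
  split=> //.
  - exact: (Binv_symplectic JJ_gacs BK BinvK).
  - exact/intA.
  - by move=> X r; rewrite tA subrr.
  - by move=> X Y Z; rewrite -(twisted_HE JJ_gacs BinvK)// H0.
apply/intJ; split=> // [X r|X Y].
  by apply/eqP; rewrite -subr_eq0 tA.
by apply: oneform_eq => Z; rewrite (twisted_HE JJ_gacs BinvK)// H0.
Qed.
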